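(* Let $n\in\mathbb N$, let $f\in L_1(\mathbb R)$ be real-valued and let $t\in\mathbb R$ be a point at which the one-sided limits $f(t+)$, $f(t-)$ exist. Suppose $f$ satisfies condition $( * )$ at the point $t$: there exists $\alpha>0$ such that $$\lim_{\omega\to\infty}\int_0^{\alpha}\left[f(t+u)-2f(t)+f(t-u)\right]\frac{\sin\omega u}{u}\,du=0 .$$ Then the transform $\widehat{\mathcal F}f(\widehat\omega)=\int_{-\infty}^{\infty}f(\tau)e^{-\widehat\omega\tau}\,d\tau$, $\widehat\omega=\sum_{k=0}^n\omega_k i_k$, is invertible at $t$, and $$\frac{f(t+)+f(t-)}{2}=\frac1{2\pi i_0}\int_{\bigotimes C^{n+1}}\widehat{\mathcal F}f(\widehat\omega)\,e^{\widehat\omega t}\,d\widehat\omega .$$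
   Context: $\bigotimes C^{n+1}$ is the tensor product over $\mathbb R$ of $n+1$ copies of the complex field: the commutative, associative, unital real algebra of dimension $2^{n+1}$ generated by $i_0,\ldots,i_n$ with $i_k^2=-1$. Put, for $p=(p_1\ldots p_n)_2\in\{0,\ldots,2^n-1\}$, $\widehat e_p=\frac1{2^n}\prod_{k=1}^n[1-(-1)^{p_k}i_0i_k]$ (orthogonal idempotents with sum $1$; $\{\widehat e_p,i_0\widehat e_p\}$ is a real basis). For $\widehat\omega=\sum_k\omega_k i_k$, $\omega_k\in\mathbb R$, one has $\widehat\omega=\sum_p\Omega_p i_0\widehat e_p$ with $\Omega_p=\omega_0+\sum_{k=1}^n(-1)^{p_k}\omega_k$, and $\widehat{\mathcal F}f(\widehat\omega)=\sum_p\mathcal Ff(i_0\Omega_p)\widehat e_p$, where $\mathcal Ff(i_0\Omega)=\int_{-\infty}^\infty f(\tau)e^{-i_0\Omega\tau}d\tau$ is the ordinary complex Fourier transform ($i_0$ playing the role of the imaginary unit). Convention of componentwise integration: for a function $\Phi(\widehat\omega)=\sum_p\Phi_p(\Omega_p)\widehat e_p$ with $\Phi_p$ taking values in $\mathbb R+\mathbb R i_0$, $$\int_{\bigotimes C^{n+1}}\Phi\,d\widehat\omega:=\sum_{p=0}^{2^n-1}\left[i_0\int_{-\infty}^{\infty}\Phi_p(\Omega)\,d\Omega\right]\widehat e_p ,$$ the integrals over $\mathbb R$ being understood, in the inversion formula, as $\lim_{R\to\infty}\int_{-R}^{R}$. *)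

(* Defs.v *)
From HB Require Import structures.
From mathcomp Require Import all_boot all_order all_algebra.
From mathcomp Require Import all_classical all_reals all_analysis.
From mathcomp Require Import ring.

Set Implicit Arguments.
Unset Strict Implicit.
Unset Printing Implicit Defensive.

Import Order.TTheory GRing.Theory Num.Theory.
Import numFieldNormedType.Exports.

Local Open Scope classical_set_scope.
Local Open Scope ring_scope.

(* The m-fold tensor power over R of the complex field.  The basis is indexed
   by subsets S of the m imaginary units, S standing for the product i_S of
   the i_k, k in S; since the i_k commute and i_k^2 = -1,
     i_A * i_B = (-1)^#|A :&: B| i_(A symdiff B). *)
Definition mcx (R : realType) (m : nat) : Type := {ffun {set 'I_m} -> R}.

HB.instance Definition _ (R : realType) (m : nat) :=
  GRing.Lmodule.copy (mcx R m) {ffun {set 'I_m} -> R}.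

Definition symdiff (T : finType) (A B : {set T}) : {set T} :=
  (A :\: B) :|: (B :\: A).

Definition mcx_one (R : realType) (m : nat) : mcx R m :=
  [ffun S : {set 'I_m} => (S == finset.set0)%:R].

Definition mcx_mul (R : realType) (m : nat) (x y : mcx R m) : mcx R m :=
  [ffun S => \sum_(A : {set 'I_m}) \sum_(B : {set 'I_m} | symdiff A B == S)
     (-1) ^+ #|A :&: B| * x A * y B].

Lemma in_symdiff (T : finType) (A B : {set T}) (x : T) :
  (x \in symdiff A B) = (x \in A) (+) (x \in B).
Proof. by rewrite !inE; case: (x \in A); case: (x \in B). Qed.

Lemma symdiffC (T : finType) : commutative (@symdiff T).
Proof. by move=> A B; apply/setP => x; rewrite !in_symdiff addbC. Qed.

Lemma symdiffA (T : finType) : associative (@symdiff T).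
Proof. by move=> A B C; apply/setP => x; rewrite !in_symdiff addbA. Qed.

Lemma symdiff0 (T : finType) (A : {set T}) : symdiff A finset.set0 = A.
Proof. by apply/setP => x; rewrite in_symdiff inE addbF. Qed.

Lemma symdiffK (T : finType) (A : {set T}) : involutive (symdiff A).
Proof. by move=> B; apply/setP => x; rewrite !in_symdiff addKb. Qed.

Lemma symdiff_eq (T : finType) (A B C : {set T}) :
  (symdiff A B == C) = (B == symdiff A C).
Proof. exact: (can2_eq (symdiffK A) (symdiffK A)). Qed.

Definition mcx_sgn (R : realType) (m : nat) (A B : {set 'I_m}) : R :=
  \prod_k (-1) ^+ ((k \in A) && (k \in B)).

Lemma mcx_sgnE (R : realType) (m : nat) (A B : {set 'I_m}) :
  (-1) ^+ #|A :&: B| = mcx_sgn R A B.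
Proof.
rewrite /mcx_sgn prodrXr -sum1_card big_mkcond /=.
by congr (_ ^+ _); apply: eq_bigr => k _; rewrite inE; case: ifP.
Qed.

Lemma mcx_sgnC (R : realType) (m : nat) (A B : {set 'I_m}) :
  mcx_sgn R A B = mcx_sgn R B A.
Proof. by apply: eq_bigr => k _; rewrite andbC. Qed.

Lemma mcx_mulE (R : realType) (m : nat) (x y : mcx R m) (S : {set 'I_m}) :
  mcx_mul x y S = \sum_A mcx_sgn R A (symdiff A S) * x A * y (symdiff A S).
Proof.
rewrite ffunE; apply: eq_bigr => A _.
under eq_bigl => B do rewrite symdiff_eq.
by rewrite big_pred1_eq mcx_sgnE.
Qed.

Lemma mcx_mulA (R : realType) (m : nat) : associative (@mcx_mul R m).
Proof.
move=> x y z; apply/ffunP => S; rewrite !mcx_mulE.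
transitivity (\sum_(B : {set 'I_m}) \sum_(A : {set 'I_m})
   mcx_sgn R B (symdiff B S) *
   mcx_sgn R (symdiff B A) (symdiff (symdiff B A) (symdiff B S)) *
   (x B * y (symdiff B A) * z (symdiff A S))).
  apply: eq_bigr => B _; rewrite mcx_mulE mulr_sumr.
  rewrite (reindex_inj (inv_inj (symdiffK B))) /=; apply: eq_bigr => A _.
  have -> : symdiff (symdiff B A) (symdiff B S) = symdiff A S.
    by apply/setP => k; rewrite !in_symdiff;
       case: (k \in A); case: (k \in B); case: (k \in S).
  by ring.
rewrite exchange_big /=; apply: eq_bigr => A _.
rewrite mcx_mulE mulr_sumr mulr_suml; apply: eq_bigr => B _.
suff -> : mcx_sgn R B (symdiff B S) *
    mcx_sgn R (symdiff B A) (symdiff (symdiff B A) (symdiff B S)) =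
    mcx_sgn R A (symdiff A S) * mcx_sgn R B (symdiff B A) by ring.
rewrite -!big_split /=; apply: eq_bigr => k _.
rewrite !in_symdiff.
by case: (k \in A); case: (k \in B); case: (k \in S) => /=; ring.
Qed.

Lemma mcx_mulC (R : realType) (m : nat) : commutative (@mcx_mul R m).
Proof.
move=> x y; apply/ffunP => S; rewrite !mcx_mulE.
have inj : injective (fun A : {set 'I_m} => symdiff A S).
  by move=> A B /=; rewrite ![symdiff _ S]symdiffC => /(inv_inj (symdiffK S)).
rewrite (reindex_inj inj) /=; apply: eq_bigr => A _.
have -> : symdiff (symdiff A S) S = A.
  by rewrite -symdiffA symdiffC -symdiffA symdiffK.
by rewrite (mcx_sgnC R _ A); ring.
Qed.

Lemma mcx_mul1 (R : realType) (m : nat) : left_id (mcx_one R m) (@mcx_mul R m).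
Proof.
move=> x; apply/ffunP => S; rewrite mcx_mulE (bigD1 finset.set0) //=.
rewrite ffunE eqxx symdiffC symdiff0 mulr1 big1 ?addr0.
  by rewrite /mcx_sgn big1 ?mul1r // => k _; rewrite inE.
by move=> A /negPf A0; rewrite ffunE A0 mulr0 mul0r.
Qed.

Lemma mcx_mulDl (R : realType) (m : nat) :
  left_distributive (@mcx_mul R m) +%R.
Proof.
move=> x y z; apply/ffunP => S; rewrite [RHS]ffunE !mcx_mulE -big_split /=.
by apply: eq_bigr => A _; rewrite ffunE mulrDr mulrDl.
Qed.

Lemma mcx_one_neq0 (R : realType) (m : nat) : mcx_one R m != 0.
Proof.
apply/eqP => /ffunP/(_ finset.set0); rewrite !ffunE eqxx => /eqP.
by rewrite oner_eq0.
Qed.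

HB.instance Definition _ (R : realType) (m : nat) :=
  GRing.Zmodule_isComNzRing.Build (mcx R m)
    (@mcx_mulA R m) (@mcx_mulC R m) (@mcx_mul1 R m) (@mcx_mulDl R m)
    (mcx_one_neq0 R m).

Lemma mcx_scalerAl (R : realType) (m : nat) (a : R) (x y : mcx R m) :
  a *: (x * y) = (a *: x) * y.
Proof.
apply/ffunP => S; rewrite ffunE !mcx_mulE scaler_sumr.
apply: eq_bigr => A _; rewrite ffunE /GRing.scale /=.
by rewrite !mulrA; congr (_ * _ * _); rewrite mulrC.
Qed.

HB.instance Definition _ (R : realType) (m : nat) :=
  GRing.Lmodule_isLalgebra.Build R (mcx R m) (@mcx_scalerAl R m).
HB.instance Definition _ (R : realType) (m : nat) :=
  GRing.Lalgebra_isComAlgebra.Build R (mcx R m).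

(* i_S as a basis vector, and the generators i_k. *)
Definition mcx_basis (R : realType) (m : nat) (A : {set 'I_m}) : mcx R m :=
  [ffun S : {set 'I_m} => (S == A)%:R].

Definition mcx_gen (R : realType) (m : nat) (k : 'I_m) : mcx R m :=
  mcx_basis R [set k]%SET.

Lemma mcx_basisM (R : realType) (m : nat) (A B : {set 'I_m}) :
  mcx_basis R A * mcx_basis R B =
  (-1) ^+ #|A :&: B| *: mcx_basis R (symdiff A B).
Proof.
apply/ffunP => S; rewrite mcx_mulE (bigD1 A) //= !ffunE eqxx mulr1.
rewrite big1 ?addr0; last first.
  by move=> C /negPf CA; rewrite ffunE CA mulr0 mul0r.
rewrite symdiff_eq; have [->|_] := eqVneq S (symdiff A B).
  by rewrite symdiffK mcx_sgnE.
by rewrite [LHS]mulr0 [RHS]mulr0.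
Qed.

Lemma mcx_gen_sqr (R : realType) (m : nat) (k : 'I_m) :
  mcx_gen R k * mcx_gen R k = -1.
Proof.
rewrite mcx_basisM finset.setIid cards1 expr1 scaleN1r; congr (- _).
by apply/ffunP => S; rewrite !ffunE; congr (_ == _)%:R;
   apply/setP => x; rewrite in_symdiff addbb inE.
Qed.

Lemma mcx_basis_prod (R : realType) (m : nat) (A : {set 'I_m}) :
  mcx_basis R A = \prod_(k in A) mcx_gen R k.
Proof.
elim: {A}#|A| {-2}A (erefl #|A|) => [|c IHc] A.
  by move/cards0_eq ->; rewrite big_set0.
case: (set_0Vmem A) => [-> |[k kA] cA]; first by rewrite cards0.
rewrite (big_setD1 k) //= -IHc; last by move: cA; rewrite (cardsD1 k) kA => -[].
rewrite mcx_basisM (_ : _ :&: _ = finset.set0) ?cards0 ?expr0 ?scale1r.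
  congr mcx_basis; apply/setP => x; rewrite in_symdiff !inE.
  by case: eqVneq => [->|//]; rewrite kA.
by apply/setP => x; rewrite !inE; case: eqVneq.
Qed.

Lemma mcx_expand (R : realType) (m : nat) (x : mcx R m) :
  x = \sum_(A : {set 'I_m}) x A *: \prod_(k in A) mcx_gen R k.
Proof.
under eq_bigr => A _ do rewrite -mcx_basis_prod.
apply/ffunP => S; rewrite sum_ffunE (bigD1 S) //= big1 => [|A /negPf AS].
  by rewrite addr0 !ffunE eqxx [RHS]mulr1.
by rewrite !ffunE eq_sym AS [LHS]mulr0.
Qed.

(* Inverses are chosen classically, so that 1 / (2 pi i_0) can be written. *)
Definition mcx_unit (R : realType) (m : nat) : {pred mcx R m} :=
  fun x => `[< exists y, y * x = 1 >].

Definition mcx_inv (R : realType) (m : nat) (x : mcx R m) : mcx R m :=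
  xget x [set y | y * x = 1].

Lemma mcx_mulVr (R : realType) (m : nat) :
  {in @mcx_unit R m, left_inverse 1 (@mcx_inv R m) *%R}.
Proof.
move=> x /asboolP[y yx]; rewrite /mcx_inv; case: xgetP => [z _ //|none].
by case: (none y).
Qed.

Lemma mcx_unitPl (R : realType) (m : nat) (x y : mcx R m) :
  y * x = 1 -> mcx_unit x.
Proof. by move=> yx; apply/asboolP; exists y. Qed.

Lemma mcx_inv_out (R : realType) (m : nat) :
  {in [predC @mcx_unit R m], @mcx_inv R m =1 id}.
Proof.
move=> x /asboolPn xNu; rewrite /mcx_inv; case: xgetP => // y _ yx.
by case: xNu; exists y.
Qed.

HB.instance Definition _ (R : realType) (m : nat) :=
  GRing.ComNzRing_hasMulInverse.Build (mcx R m)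
    (@mcx_mulVr R m) (@mcx_unitPl R m) (@mcx_inv_out R m).

(* Coefficientwise sum of the power series. *)
Definition mcx_exp (R : realType) (m : nat) (x : mcx R m) : mcx R m :=
  [ffun S => limn (series (fun j : nat => ((j`!%:R : R)^-1 *: x ^+ j) S))].

(* Lebesgue measure on the sigma-algebra of all Lebesgue-measurable sets, so
   that functions in L_1 need not be Borel measurable. *)
Notation leb := (completed_lebesgue_measure).

(* omega_0 i_0 + ... + omega_n i_n. *)
Definition mcx_hat (R : realType) (n : nat) (w : 'I_n.+1 -> R) : mcx R n.+1 :=
  \sum_(k < n.+1) w k *: mcx_gen R k.

(* The digit p_k of p = (p_1 ... p_n)_2, where k = j + 1; p_1 is the leading
   binary digit.  In the same way, lift ord0 j below is the index k. *)
Definition digit (n : nat) (p : 'I_(2 ^ n)) (j : 'I_n) : bool :=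
  odd (p %/ 2 ^ (n - j.+1)).

Definition mcx_idem (R : realType) (n : nat) (p : 'I_(2 ^ n)) : mcx R n.+1 :=
  ((2 ^ n)%:R : R)^-1 *:
    \prod_(j < n)
      (1 - (-1) ^+ digit p j *: (mcx_gen R ord0 * mcx_gen R (lift ord0 j))).

Definition mcx_Omega (R : realType) (n : nat) (w : 'I_n.+1 -> R)
    (p : 'I_(2 ^ n)) : R :=
  w ord0 + \sum_(j < n) (-1) ^+ digit p j * w (lift ord0 j).

(* x |-> the integral over the real line of f(tau) e^(- x tau), taken
   coefficientwise. *)
Definition mcx_fourier (R : realType) (m : nat) (f : R -> R) (x : mcx R m) :
    mcx R m :=
  [ffun S => \int[leb]_(tau in setT) (f tau * mcx_exp (- (tau *: x)) S)].

(* a + b i_0. *)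
Definition mcx_cplx (R : realType) (n : nat) (a b : R) : mcx R n.+1 :=
  a%:A + b *: mcx_gen R ord0.

(* v is the componentwise integral of Phi, where Phi_p = a_p + b_p i_0 and the
   integrals over R are limits of the integrals over [-r, r].  The components
   are determined by Phi because the e_p, i_0 e_p form a real basis and each
   Omega_p takes all real values. *)
Definition is_mcx_integral (R : realType) (n : nat)
    (Phi : mcx R n.+1 -> mcx R n.+1) (v : mcx R n.+1) : Prop :=
  exists (a b : 'I_(2 ^ n) -> R -> R) (Ia Ib : 'I_(2 ^ n) -> R),
  [/\ forall w : 'I_n.+1 -> R,
        Phi (mcx_hat w) =
        \sum_p mcx_cplx n (a p (mcx_Omega w p)) (b p (mcx_Omega w p))
               * mcx_idem R p,
      forall p (r : R), leb.-integrable `[- r, r] (EFin \o a p) /\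
                        leb.-integrable `[- r, r] (EFin \o b p),
      forall p, (\int[leb]_(u in `[- r, r]) a p u) @[r --> +oo] --> Ia p /\
                (\int[leb]_(u in `[- r, r]) b p u) @[r --> +oo] --> Ib p &
      v = \sum_p (mcx_gen R ord0 * mcx_cplx n (Ia p) (Ib p)) * mcx_idem R p].

Definition mcx_integrable (R : realType) (n : nat)
    (Phi : mcx R n.+1 -> mcx R n.+1) : Prop :=
  exists v, is_mcx_integral Phi v.

(* Meaningful only when Phi is integrable; the default value is 0. *)
Definition mcx_integral (R : realType) (n : nat)
    (Phi : mcx R n.+1 -> mcx R n.+1) : mcx R n.+1 :=
  xget 0 [set v | is_mcx_integral Phi v].

Definition condition_star (R : realType) (f : R -> R) (t : R) : Prop :=
  exists2 alpha : R, 0 < alpha &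
    (\int[leb]_(u in `[0, alpha])
       ((f (t + u) - 2 * f t + f (t - u)) * (sin (w * u) / u)))
    @[w --> +oo] --> (0 : R).

(* Main.v *)
Require Import Defs.
From HB Require Import structures.
From mathcomp Require Import all_boot all_order all_algebra.
From mathcomp Require Import all_classical all_reals all_analysis.
From mathcomp Require Import measurable_realfun ring lra.

Set Implicit Arguments.
Unset Strict Implicit.
Unset Printing Implicit Defensive.

Import Order.TTheory GRing.Theory Num.Theory.
Import numFieldNormedType.Exports.
Local Open Scope classical_set_scope.
Local Open Scope ring_scope.

(** The e_p are orthogonal idempotents with sum 1, and i_k e_p is plus or minus
    i_0 e_p; hence the algebra is a product of 2^n copies of the complex field
    R + R i_0, and omega has p-th coordinate Omega_p i_0.  Exponential and
    transform are computed coordinate by coordinate ([mcx_exp_hat],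
    [mcx_fourier_hat]), so that the integrand of the inversion formula has
    p-th coordinate A(Omega_p) + B(Omega_p) i_0 ([mcx_Phi_hat]), where A(v) and
    B(v) are the integrals over tau of f(tau) cos(v (tau - t)) and
    - f(tau) sin(v (tau - t)).  These components are determined by the
    integrand ([is_mcx_integral_unique]), and everything reduces to the real
    limits of the integrals of A and B over [-r, r].

    Fold the line at t and put g(u) = f(t+u) + f(t-u) for u > 0.  The function B
    is odd and integrates to 0.  Differentiation under the integral sign shows
    that the integral of A over [-r, r] is twice the integral of g(u) sin(ru)/u
    over u > 0 ([Rintegral_cosine_transform]).  In the latter:
    - on ]0, alpha] the hypothesis of the theorem allows g to be replaced by the
      constant 2 f(t), and the integral of sin(ru)/u over ]0, alpha] tends to
      pi/2 ([dirichlet_cvg]);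
    - beyond alpha, g(u)/u is integrable and the Riemann-Lebesgue lemma applies
      ([Riemann_Lebesgue]).
    The limit is pi f(t), and it remains to see that 2 f(t) = fr + fl
    ([star_midpoint]).  This follows from the same hypothesis by averaging over
    the frequency: the integral H(w) of (g(u) - 2 f(t)) (1 - cos(wu))/u^2 over
    ]0, alpha] has as its derivative the integral that tends to 0, so
    H(w) = o(w); but the kernel is nonnegative with mass of order w near 0, so
    that a nonzero limit of g - 2 f(t) at 0 would make H(w) of order w
    ([Fejer_limit_le0]).

    Since f is only Lebesgue measurable, all integrals are taken for the
    completed Lebesgue measure.  It is invariant under u |-> c + u and
    u |-> c - u ([leb_isometry_set]) and agrees with Lebesgue measure on Borel
    functions ([Rintegral_leb]). *)

(** * The idempotents and the coordinates of the algebra *)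

Section Idempotents.
Variables (R : realType) (n : nat).
Implicit Types (p q : 'I_(2 ^ n)) (w : 'I_n.+1 -> R).

Local Notation i0 := (@mcx_gen R n.+1 ord0).
Let g (j : 'I_n) : mcx R n.+1 := i0 * mcx_gen R (lift ord0 j).

Lemma mcx_i0ik_sqr (j : 'I_n) : g j * g j = 1.
Proof. by rewrite /g mulrACA !mcx_gen_sqr mulrNN mulr1. Qed.

(** The quotients of p by 2^n, 2^(n-1), ..., 1 are rebuilt one digit at a time,
    starting from 0. *)
Lemma digit_inj p q : digit p =1 digit q -> p = q.
Proof.
move=> pq; apply: val_inj => /=.
have key k : (k <= n -> p %/ 2 ^ k = q %/ 2 ^ k)%N.
  move=> kn; rewrite -(subKn kn); elim: (n - k)%N (leq_subr k n) => [|d IH] dn.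
    by rewrite subn0 !divn_small.
  have := pq (Ordinal dn); rewrite /digit /= => od.
  have step (x : nat) : x = (odd x + (x %/ 2).*2)%N.
    by rewrite divn2 odd_double_half.
  rewrite (step (p %/ _)%N) (step (q %/ _)%N) od -!divnMA.
  by rewrite -expnSr -(subSn dn) subSS IH // ltnW.
by have := key 0 (leq0n n); rewrite expn0 !divn1.
Qed.

Lemma mcx_idem_factor p :
  mcx_idem R p = \prod_(j < n) (2^-1 *: (1 - (-1) ^+ digit p j *: g j)).
Proof.
by rewrite scaler_prod prodr_const card_ord /mcx_idem natrX exprVn.
Qed.

(** Expand the product over j of the sums over both signs, each of which is 1;
    the sign vectors correspond to the p through their digits. *)
Lemma mcx_idem_sum : \sum_(p < 2 ^ n) mcx_idem R p = 1.
Proof.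
pose F (j : 'I_n) (b : bool) : mcx R n.+1 := 2^-1 *: (1 - (-1) ^+ b *: g j).
have F1 j : \sum_b F j b = 1.
  rewrite big_bool /F /= expr0 expr1 scale1r scaleN1r -scalerDr opprK.
  rewrite addrACA subrr addr0 scalerDr -scalerDl.
  by rewrite [X in X *: _](_ : _ = 1) ?scale1r //; field.
have -> : 1 = \prod_(j < n) \sum_b F j b by rewrite big1.
rewrite bigA_distr_bigA /=.
pose D p : {ffun 'I_n -> bool} := [ffun j => digit p j].
have Dinj : injective D.
  by move=> p q /ffunP pq; apply: digit_inj => j; have := pq j; rewrite !ffunE.
have [E DE ED] : bijective D.
  by apply: inj_card_bij => //; rewrite card_ffun card_bool !card_ord.
rewrite (reindex D) /=; last by exists E => x _; [exact: DE|exact: ED].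
by apply: eq_bigr => p _; rewrite mcx_idem_factor; apply: eq_bigr => j _; rewrite ffunE.
Qed.

(** Where the digits differ, the factors 1 - g and 1 + g multiply to 1 - g^2 = 0. *)
Lemma mcx_idem_orth p q : p != q -> mcx_idem R p * mcx_idem R q = 0.
Proof.
move=> npq; have [j dj] : exists j, digit p j != digit q j.
  apply/existsP; apply: contraR npq; rewrite negb_exists => /forallP pq.
  by apply/eqP/digit_inj => j; have := pq j; rewrite negbK => /eqP.
rewrite !mcx_idem_factor -big_split (bigD1 j) //=.
rewrite -scalerAl -scalerAr.
suff -> : (1 - (-1) ^+ digit p j *: g j) * (1 - (-1) ^+ digit q j *: g j) = 0.
  by rewrite !scaler0 mul0r.
move: dj; case: (digit p j); case: (digit q j) => // _;
  rewrite ?expr0 ?expr1 ?scale1r ?scaleN1r ?opprK.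
  by rewrite mulrBr mulr1 mulrDl mul1r mcx_i0ik_sqr (addrC _ 1) subrr.
by rewrite mulrDr mulr1 mulrBl mul1r mcx_i0ik_sqr addrA addrNK subrr.
Qed.

Lemma mcx_idem_idem p : mcx_idem R p * mcx_idem R p = mcx_idem R p.
Proof.
rewrite -[RHS]mulr1 -mcx_idem_sum mulr_sumr (bigD1 p) //=.
by rewrite big1 ?addr0 // => q qp; rewrite mcx_idem_orth // eq_sym.
Qed.

(** On the image of e_p the unit i_k acts as plus or minus i_0: multiply the
    factor 1 - s i_0 i_k of e_p by i_k and by s i_0. *)
Lemma mcx_gen_idem p j :
  mcx_gen R (lift ord0 j) * mcx_idem R p =
  ((-1) ^+ digit p j) *: (i0 * mcx_idem R p).
Proof.
rewrite mcx_idem_factor (bigD1 j) //= !mulrA [RHS]scalerAl; congr (_ * _).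
set s := (-1) ^+ digit p j.
rewrite -!scalerAr [RHS]scalerA [s * _]mulrC -[RHS]scalerA; congr (_ *: _).
have ss : s * s = 1 by rewrite /s -expr2 sqrr_sign.
have e1 : mcx_gen R (lift ord0 j) * g j = - i0.
  by rewrite /g mulrCA mcx_gen_sqr mulrN1.
have e2 : i0 * g j = - mcx_gen R (lift ord0 j).
  by rewrite /g mulrA mcx_gen_sqr mulN1r.
rewrite !mulrBr !mulr1 -!scalerAr e1 e2 scalerBr scalerA ss scale1r.
by rewrite scalerN !opprK addrC.
Qed.

Lemma mcx_hat_idem w p :
  mcx_hat w * mcx_idem R p = mcx_Omega w p *: (i0 * mcx_idem R p).
Proof.
rewrite /mcx_hat big_ord_recl mulrDl /mcx_Omega scalerDl -scalerAl; congr (_ + _).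
rewrite mulr_suml scaler_suml; apply: eq_bigr => j _.
by rewrite -scalerAl mcx_gen_idem scalerA mulrC.
Qed.

Lemma mcx_Omega_surj p x : exists w, mcx_Omega w p = x.
Proof.
exists (fun k => if k == ord0 then x else 0); rewrite /mcx_Omega eqxx.
by rewrite big1 ?addr0 // => j _; rewrite eq_sym (negPf (neq_lift _ _)) mulr0.
Qed.

(** The coefficient of e_p at the empty set is 2^-n.  Indeed a product of
    factors 1 - s i_0 i_j is supported on sets that avoid the indices not yet
    used, so a new term i_0 i_j cannot reach the empty set. *)
Lemma mcx_idem_neq0 p : mcx_idem R p != 0.
Proof.
pose P (s : seq 'I_n) : mcx R n.+1 := \prod_(j <- s) (1 - (-1) ^+ digit p j *: g j).
pose A (j : 'I_n) : {set 'I_n.+1} := symdiff [set ord0]%SET [set lift ord0 j]%SET.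
have mulg (x : mcx R n.+1) j (S : {set 'I_n.+1}) :
    (g j * x) S = mcx_sgn R (A j) (symdiff (A j) S) * x (symdiff (A j) S).
  rewrite /g /mcx_gen mcx_basisM -scalerAl ffunE.
  have -> : [set ord0] :&: [set lift ord0 j] = finset.set0 :> {set 'I_n.+1}.
    by apply/setP => k; rewrite !inE; case: eqP => // ->; rewrite (negPf (neq_lift _ _)).
  rewrite cards0 expr0 [LHS]mul1r mcx_mulE (bigD1 (A j)) //= big1 ?addr0; last first.
    by move=> B /negPf BA; rewrite ffunE BA mulr0 mul0r.
  by rewrite ffunE eqxx mulr1.
have supp s : uniq s -> P s finset.set0 = 1 /\
    forall (S : {set 'I_n.+1}) j, j \notin s -> lift ord0 j \in S -> P s S = 0.
  elim: s => [_|i s IH /= /andP[nis us]].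
    rewrite /P big_nil; split=> [|S j _ jS]; first by rewrite ffunE eqxx.
    by rewrite ffunE; case: eqP => // S0; move: jS; rewrite S0 inE.
  have [P0 PS] := IH us; rewrite /P big_cons -/(P s).
  have E (S : {set 'I_n.+1}) : ((1 - (-1) ^+ digit p i *: g i) * P s) S =
      P s S - (-1) ^+ digit p i * (g i * P s) S.
    by rewrite mulrBl mul1r -scalerAl !ffunE.
  split; first rewrite E P0 mulg (PS _ i nis) ?mulr0 ?mulr0 ?subr0 //.
    by rewrite /A !in_symdiff !inE eqxx eq_sym (negPf (neq_lift _ _)).
  move=> S j; rewrite inE negb_or => /andP[ji js] jS.
  rewrite E (PS _ j) // mulg (PS _ j js) ?mulr0 ?mulr0 ?subr0 //.
  rewrite /A !in_symdiff !inE jS eq_sym (negPf (neq_lift _ _)).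
  by rewrite (inj_eq lift_inj) (negPf ji).
apply/eqP => /ffunP/(_ finset.set0); rewrite /mcx_idem.
have [+ _] := supp (enum 'I_n) (enum_uniq _).
rewrite /P big_enum /= => P1; rewrite ffunE P1 [_ *: _]mulr1 ffunE => /eqP.
by rewrite invr_eq0 pnatr_eq0 expn_eq0.
Qed.

Lemma mcx_cplxE (a b : R) : mcx_cplx n a b = a%:A + b%:A * i0.
Proof. by rewrite /mcx_cplx mulr_algl. Qed.

Lemma mcx_cplxM (a b c d : R) :
  mcx_cplx n a b * mcx_cplx n c d = mcx_cplx n (a * c - b * d) (a * d + b * c).
Proof.
rewrite !mcx_cplxE scalerBl scalerDl -!scalerA -!(mulr_algl _ (_%:A)).
have i2 : i0 * i0 = -1 := mcx_gen_sqr R ord0.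
by ring: i2.
Qed.

Lemma mcx_cplxB (a b c d : R) :
  mcx_cplx n a b - mcx_cplx n c d = mcx_cplx n (a - c) (b - d).
Proof. by rewrite /mcx_cplx !scalerBl opprD addrACA. Qed.

(** Multiply the difference by its conjugate: (x^2 + y^2) e_p = 0. *)
Lemma mcx_cplx_idem_inj p a b c d :
  mcx_cplx n a b * mcx_idem R p = mcx_cplx n c d * mcx_idem R p ->
  a = c /\ b = d.
Proof.
move/eqP; rewrite -subr_eq0 -mulrBl mcx_cplxB.
move/eqP/(congr1 (fun x => mcx_cplx n (a - c) (- (b - d)) * x)).
rewrite mulr0 mulrA mcx_cplxM => /eqP.
rewrite (_ : _ * (b - d) + _ = 0); last by rewrite mulNr mulrC subrr.
rewrite /mcx_cplx scale0r addr0 mulr_algl scaler_eq0 (negPf (mcx_idem_neq0 p)) orbF.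
rewrite mulNr opprK -!expr2 paddr_eq0 ?sqr_ge0 // !sqrf_eq0 !subr_eq0.
by move=> /andP[/eqP-> /eqP->].
Qed.

Lemma mcx_comp_mul_idem (a b : 'I_(2 ^ n) -> R) p :
  (\sum_q mcx_cplx n (a q) (b q) * mcx_idem R q) * mcx_idem R p =
  mcx_cplx n (a p) (b p) * mcx_idem R p.
Proof.
rewrite mulr_suml (bigD1 p) //= big1 ?addr0 => [|q qp].
  by rewrite -mulrA mcx_idem_idem.
by rewrite -mulrA mcx_idem_orth // mulr0.
Qed.

(** Since Omega_p takes every real value, multiplying the decomposition by e_p
    recovers the components as functions, and limits are unique. *)
Lemma is_mcx_integral_unique (Phi : mcx R n.+1 -> mcx R n.+1) v v' :
  is_mcx_integral Phi v -> is_mcx_integral Phi v' -> v = v'.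
Proof.
move=> [a [b [Ia [Ib [Pab _ lim ->]]]]] [c [d [Ic [Id [Pcd _ lim' ->]]]]].
have abcd p x : a p x = c p x /\ b p x = d p x.
  have [w <-] := mcx_Omega_surj p x; apply: (@mcx_cplx_idem_inj p).
  rewrite -(mcx_comp_mul_idem (fun q => a q (mcx_Omega w q)) (fun q => b q (mcx_Omega w q))).
  by rewrite -Pab Pcd mcx_comp_mul_idem.
apply: eq_bigr => p _.
have ac : a p = c p by apply/funext => x; have [] := abcd p x.
have bd : b p = d p by apply/funext => x; have [] := abcd p x.
have [La Lb] := lim p; have [Lc Ld] := lim' p; rewrite ac in La; rewrite bd in Lb.
by rewrite (cvg_unique _ La Lc) // (cvg_unique _ Lb Ld).
Qed.

End Idempotents.

(** * The exponential in coordinates *)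

Section Exponential.
Variables (R : realType) (n : nat).
Implicit Types (p q : 'I_(2 ^ n)) (w : 'I_n.+1 -> R).
Local Notation i0 := (@mcx_gen R n.+1 ord0).

Lemma mcx_comp_coef (a b : 'I_(2 ^ n) -> R) (S : {set 'I_n.+1}) :
  (\sum_p mcx_cplx n (a p) (b p) * mcx_idem R p) S =
  \sum_p (a p * mcx_idem R p S + b p * (i0 * mcx_idem R p) S).
Proof.
rewrite sum_ffunE; apply: eq_bigr => p _.
by rewrite /mcx_cplx mulrDl mulr_algl -scalerAl !ffunE.
Qed.

Lemma mcx_gen0X j : i0 ^+ j =
  mcx_cplx n ((~~ odd j)%:R * (-1) ^+ j./2) ((odd j)%:R * (-1) ^+ j.-1./2).
Proof.
elim: j => [|j IH]; first by rewrite /mcx_cplx /= mulr1 mul0r scale0r scale1r addr0.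
have i1 : i0 = mcx_cplx n 0 1 by rewrite /mcx_cplx scale0r add0r scale1r.
rewrite exprSr IH [X in _ * X]i1 mcx_cplxM !mulr0 !mulr1 addr0 sub0r; congr mcx_cplx.
rewrite /= negbK; case: j {IH} => [|j] /=; first by rewrite !mul0r oppr0.
by rewrite exprS mulN1r mulrN.
Qed.

(** On e_p the j-th power of s omega is (s Omega_p)^j i_0^j, so the exponential
    series splits into the cosine and the sine series of s Omega_p. *)
Lemma mcx_exp_hat (s : R) w : mcx_exp (s *: mcx_hat w) =
  \sum_p mcx_cplx n (cos (s * mcx_Omega w p)) (sin (s * mcx_Omega w p))
         * mcx_idem R p.
Proof.
have termE j : (j`!%:R : R)^-1 *: (s *: mcx_hat w) ^+ j =
  \sum_p mcx_cplx n (cos_coeff (s * mcx_Omega w p) j)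
    (sin_coeff (s * mcx_Omega w p) j) * mcx_idem R p.
  rewrite -[LHS]mulr1 -(mcx_idem_sum R n) mulr_sumr; apply: eq_bigr => p _.
  rewrite -scalerAl; have -> : (s *: mcx_hat w) ^+ j * mcx_idem R p =
      (s * mcx_Omega w p) ^+ j *: (i0 ^+ j * mcx_idem R p).
    elim: j => [|j IH]; first by rewrite !expr0 scale1r.
    rewrite exprS -mulrA IH -scalerAr mulrCA -(scalerAl s) mcx_hat_idem.
    by rewrite scalerA -scalerAr scalerA -exprSr mulrA -exprSr.
  rewrite scalerA mcx_gen0X scalerAl; congr (_ * _).
  rewrite /mcx_cplx scalerDr !scalerA /cos_coeff /sin_coeff /=.
  by congr (_ *: _ + _ *: _); rewrite mulrC [_ * _ ^+ j]mulrC -mulrA.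
apply/ffunP => S; rewrite ffunE mcx_comp_coef.
have -> : (fun j => ((j`!%:R : R)^-1 *: (s *: mcx_hat w) ^+ j) S) = (fun j =>
    \sum_p (cos_coeff (s * mcx_Omega w p) j * mcx_idem R p S +
            sin_coeff (s * mcx_Omega w p) j * (i0 * mcx_idem R p) S)).
  by apply/funext => j; rewrite termE mcx_comp_coef.
apply/cvg_lim => //.
have -> : series (fun j =>
    \sum_p (cos_coeff (s * mcx_Omega w p) j * mcx_idem R p S +
            sin_coeff (s * mcx_Omega w p) j * (i0 * mcx_idem R p) S)) =
  (fun N => \sum_p (series (cos_coeff (s * mcx_Omega w p)) N * mcx_idem R p S +
            series (sin_coeff (s * mcx_Omega w p)) N * (i0 * mcx_idem R p) S)).
  apply/funext => N; rewrite /series /= exchange_big /=; apply: eq_bigr => p _.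
  by rewrite big_split /= !mulr_suml.
apply: cvg_big => [|p _]; first exact: add_continuous.
apply: cvgD; apply: cvgM; try exact: cvg_cst.
  by rewrite [in X in _ --> X]unlock; exact: is_cvg_series_cos_coeff.
by rewrite [in X in _ --> X]unlock; exact: is_cvg_series_sin_coeff.
Qed.

Lemma mcx_compM (a b c d : 'I_(2 ^ n) -> R) :
  (\sum_p mcx_cplx n (a p) (b p) * mcx_idem R p) *
  (\sum_p mcx_cplx n (c p) (d p) * mcx_idem R p) =
  \sum_p mcx_cplx n (a p * c p - b p * d p) (a p * d p + b p * c p) * mcx_idem R p.
Proof.
rewrite -[LHS]mulr1 -(mcx_idem_sum R n) [LHS]mulr_sumr; apply: eq_bigr => p _.
by rewrite -mulrA mcx_comp_mul_idem mulrCA mcx_comp_mul_idem mulrCA mulrA mcx_cplxM.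
Qed.

(** The factor i_0 of the componentwise integral cancels against 1 / (2 pi i_0). *)
Lemma mcx_2pi_i0_inv (c : R) :
  ((2 * pi) *: i0)^-1 *
    (\sum_p (i0 * mcx_cplx n (2 * pi * c) 0) * mcx_idem R p) = c%:A.
Proof.
have pi0 : (2 * pi : R) != 0 by rewrite mulf_neq0 // gt_eqF // pi_gt0.
have u : (2 * pi) *: i0 \is a GRing.unit.
  apply/unitrP; exists (- (2 * pi)^-1 *: i0).
  rewrite [X in _ /\ X = _]mulrC; split.
    by rewrite -scalerAl -scalerAr mcx_gen_sqr scalerA mulNr mulVf // scaleN1r opprK.
  by rewrite -scalerAl -scalerAr mcx_gen_sqr scalerA mulNr mulVf // scaleN1r opprK.
under eq_bigr => p _ do rewrite /mcx_cplx scale0r addr0.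
rewrite -mulr_sumr mcx_idem_sum mulr1.
have -> : i0 * (2 * pi * c)%:A = ((2 * pi) *: i0) * c%:A.
  by rewrite !mulr_algr scalerA mulrC.
by rewrite mulrA mulVr // mul1r.
Qed.

End Exponential.

(** * Transport of integrals along measure-preserving maps *)

Section Transport.
Variables (d1 d2 : measure_display) (X : measurableType d1) (Y : measurableType d2).
Variables (K : realType) (m1 : {measure set X -> \bar K}) (m2 : {measure set Y -> \bar K}).
Variable phi : X -> Y.
Hypothesis mphi : measurable_fun setT phi.
Hypothesis m12 : forall A, measurable A -> m1 (phi @^-1` A) = m2 A.
Variable D : set Y.
Hypothesis mD : measurable D.

Lemma ge0_integral_transport (f : Y -> \bar K) :
  measurable_fun D f -> (forall y, 0 <= f y)%E ->
  (\int[m2]_(y in D) f y = \int[m1]_(x in phi @^-1` D) f (phi x))%E.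
Proof.
move=> mf f0; transitivity (\int[pushforward m1 phi]_(y in D) f y)%E.
  pose m : {measure set Y -> \bar K} :=
    measure_function_pushforward__canonical__measure_function_Measure m1 mphi.
  by apply: (@eq_measure_integral _ _ _ D m m2) => A mA _; rewrite -m12.
by rewrite ge0_integral_pushforward.
Qed.

Lemma integral_transport (f : Y -> \bar K) : measurable_fun D f ->
  (\int[m2]_(y in D) f y = \int[m1]_(x in phi @^-1` D) f (phi x))%E.
Proof.
move=> mf; rewrite integralE -[RHS]/(\int[m1]_(x in phi @^-1` D) (f \o phi) x)%E.
rewrite [RHS]integralE (funepos_comp f phi) (funeneg_comp f phi) !ge0_integral_transport //.
  exact: measurable_funeneg.
exact: measurable_funepos.
Qed.

Lemma integrable_transport (f : Y -> \bar K) : measurable_fun D f ->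
  m2.-integrable D f <-> m1.-integrable (phi @^-1` D) (f \o phi).
Proof.
move=> mf; have mfphi : measurable_fun (phi @^-1` D) (f \o phi).
  apply: measurable_comp mf _ => //; last exact: measurable_funTS.
  by move=> _ [x Dx <-].
have E : (\int[m2]_(y in D) `|f y| =
          \int[m1]_(x in phi @^-1` D) `|(f \o phi) x|)%E.
  by rewrite ge0_integral_transport //; exact: measurableT_comp.
by split=> /integrableP[_ fin]; apply/integrableP; split; rewrite // ?E // -E.
Qed.

Lemma Rintegral_transport (f : Y -> K) : measurable_fun D f ->
  \int[m2]_(y in D) f y = \int[m1]_(x in phi @^-1` D) f (phi x).
Proof.
by move=> mf; rewrite /Rintegral integral_transport //; exact/measurable_EFinP.
Qed.

End Transport.

(** * The completed Lebesgue measure *)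

Section LebesgueMeasurable.
Variable R : realType.

(** The measurable space on which a given measure is defined.  It names the
    Caratheodory sigma-algebra carried by the completed Lebesgue measure, whose
    underlying type is R itself. *)
Definition measure_domain d (T : measurableType d) (K : realType)
  (m : {measure set T -> \bar K}) : measurableType d := T.

Definition lebT : measurableType _ :=
  @measure_domain _ _ R (leb : {measure set _ -> \bar R}).

Local Notation mu := (leb : {measure set lebT -> \bar R}).
Local Notation lam := (@lebesgue_measure R).

Lemma leb_measurable_set (A : set R) : measurable A -> measurable (A : set lebT).
Proof. by move=> mA; apply: sub_caratheodory; exact: mA. Qed.

Lemma leb_measurable_fun (D : set lebT) (f : R -> R) :
  measurable_fun setT f -> measurable_fun D (f : lebT -> R).
Proof.
move=> mf; apply: (@measurable_funTS _ _ lebT R) => _ Y mY.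
by apply: leb_measurable_set; exact: mf.
Qed.

Lemma leb_measurable_id :
  measurable_fun [set: lebT] (idfun : lebT -> measurableTypeR R).
Proof. by move=> _ Y mY; rewrite setTI; exact: leb_measurable_set. Qed.

Lemma Rintegral_leb (D : set R) (f : R -> R) : measurable D ->
  measurable_fun D f ->
  \int[mu]_(x in D) f x = \int[lam]_(x in D) f x.
Proof.
move=> mD mf.
by rewrite (@Rintegral_transport _ _ lebT (measurableTypeR R) R mu lam _
   leb_measurable_id).
Qed.

Lemma integrable_leb (D : set R) (f : R -> R) : measurable D ->
  measurable_fun D f ->
  lam.-integrable D (EFin \o f) -> mu.-integrable D (EFin \o f).
Proof.
move=> mD mf.
by move/(@integrable_transport _ _ lebT (measurableTypeR R) R mu lam _
   leb_measurable_id); apply => //; exact/measurable_EFinP.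
Qed.

Section Isometry.
Variables (c s : R).
Hypothesis s2 : s * s = 1.
Let phi (u : R) : R := c + s * u.

Let mphi : measurable_fun [set: R] phi.
Proof.
apply: continuous_measurable_fun => x.
by apply: cvgD; [exact: cvg_cst|apply: cvgM; [exact: cvg_cst|exact: cvg_id]].
Qed.

(** As s is 1 or -1, the preimage of ]a, b] is an interval of the same length. *)
Lemma lebesgue_measure_isometry (A : set R) : measurable A ->
  lam (phi @^-1` A) = lam A.
Proof.
move=> mA; have mphi' : measurable_fun [set: measurableTypeR R]
  (phi : measurableTypeR R -> measurableTypeR R) by exact: mphi.
pose m : {measure set (measurableTypeR R) -> \bar R} :=
   measure_function_pushforward__canonical__measure_function_Measure lam mphi'.
suff mm X : ocitv X -> lam X = m X.
  exact/esym/(@lebesgue_measure_unique R m mm).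
move=> [[a b] _ <-] /=.
have /orP[/eqP s1|/eqP s1] : (s == 1) || (s == -1) by rewrite -eqf_sqr expr1n expr2 s2.
  rewrite /m /= /pushforward (_ : phi @^-1` _ = `]a - c, b - c]%classic); last first.
    by apply/seteqP; split=> u /=; rewrite !in_itv /= /phi s1; lra.
  by rewrite !lebesgue_measure_itv /= !lte_fin ltrD2r; case: ifP => // _;
     congr (_%:E); ring.
rewrite /m /= /pushforward (_ : phi @^-1` _ = `[c - b, c - a[%classic); last first.
  by apply/seteqP; split=> u /=; rewrite !in_itv /= /phi s1; lra.
by rewrite !lebesgue_measure_itv /= !lte_fin ltrD2l ltrN2; case: ifP => // _; congr (_%:E); ring.
Qed.

(** A Lebesgue-measurable set is a Borel set together with a part of a Borel
    null set. *)
Lemma leb_decomp (A : set R) : measurable (A : set lebT) ->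
  exists B N C : set R, [/\ measurable B, measurable C, lam C = 0%E,
    N `<=` C & A = B `|` N].
Proof.
move=> mA.
have : ((completed_algebra_gen lam).-sigma.-measurable) A.
  by rewrite completed_caratheodory_measurable.
rewrite g_sigma_completed_algebra_genE => -[B mB [N [C [mC C0 NC]] <-]].
by exists B, N, C.
Qed.

Lemma leb_negligible (N C : set R) : measurable C -> lam C = 0%E -> N `<=` C ->
  measurable (N : set lebT).
Proof.
move=> mC C0 NC; apply: negligible_sub_caratheodory.
by exists C; split => //; exact: leb_measurable_set.
Qed.

Lemma leb_setU_negligible (B N C : set R) : measurable B -> measurable C ->
  lam C = 0%E -> N `<=` C -> mu (B `|` N) = lam B.
Proof.
move=> mB mC C0 NC.
have mB' := leb_measurable_set mB; have mN := leb_negligible mC C0 NC.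
rewrite measureU0 //.
apply/eqP; rewrite eq_le measure_ge0 andbT -C0.
by apply: (@le_measure _ _ _ mu) => //; rewrite inE //; exact: leb_measurable_set.
Qed.

(** The Borel part is handled by invariance of Lebesgue measure, the null part
    by completeness. *)
Lemma leb_isometry_set (A : set R) : measurable (A : set lebT) ->
  measurable (phi @^-1` A : set lebT) /\ mu (phi @^-1` A) = mu A.
Proof.
move=> /leb_decomp[B [N [C [mB mC C0 NC ->]]]].
have mpre (X : set R) : measurable X -> measurable (phi @^-1` X).
  by move=> mX; rewrite -[X in measurable X]setTI; exact: mphi.
have pC0 : lam (phi @^-1` C) = 0%E by rewrite lebesgue_measure_isometry.
have pNC : phi @^-1` N `<=` phi @^-1` C by move=> x; exact: NC.
rewrite preimage_setU; split.
  apply: measurableU; first by apply: leb_measurable_set; exact: mpre.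
  exact: leb_negligible (mpre _ mC) pC0 pNC.
rewrite (leb_setU_negligible mB mC) // (leb_setU_negligible (mpre _ mB) (mpre _ mC)) //.
exact: lebesgue_measure_isometry.
Qed.

Lemma leb_isometry_measurable : measurable_fun [set: lebT] (phi : lebT -> lebT).
Proof. by move=> _ Y mY; rewrite setTI; exact: (leb_isometry_set mY).1. Qed.

Lemma leb_isometry_measure (A : set lebT) : measurable A ->
  mu ((phi : lebT -> lebT) @^-1` A) = mu A.
Proof. by move=> mA; exact: (leb_isometry_set mA).2. Qed.

Lemma integrable_leb_isometry (D : set R) (f : R -> R) : measurable (D : set lebT) ->
  mu.-integrable D (EFin \o f) ->
  mu.-integrable (phi @^-1` D) (EFin \o (f \o phi)).
Proof.
move=> mD intf; apply/(@integrable_transport _ _ lebT lebT R mu mu _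
   leb_isometry_measurable leb_isometry_measure _ mD (EFin \o f)) => //.
exact: measurable_int intf.
Qed.

Lemma Rintegral_leb_isometry (D : set R) (f : R -> R) : measurable (D : set lebT) ->
  mu.-integrable D (EFin \o f) ->
  \int[mu]_(x in D) f x = \int[mu]_(x in phi @^-1` D) f (phi x).
Proof.
move=> mD intf; apply: (@Rintegral_transport _ _ lebT lebT R mu mu _
   leb_isometry_measurable leb_isometry_measure _ mD f).
exact/measurable_EFinP/(measurable_int _ intf).
Qed.

End Isometry.

Lemma leb_itv (a b : R) (x y : bool) : a <= b ->
  mu [set` Interval (BSide x a) (BSide y b)] = (b - a)%:E.
Proof.
move=> ab; rewrite -[LHS]/(lam _) lebesgue_measure_itv /= lte_fin.
by case: ltgtP ab => // -> _; rewrite subrr.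
Qed.

End LebesgueMeasurable.

(** * Trigonometric inequalities *)

Section TrigonometricBounds.
Variable R : realType.
Implicit Types x y : R.

Lemma ler_norm_sin x : `|sin x| <= `|x|.
Proof.
wlog x0 : x / 0 <= x => [wh|].
  case/orP: (le_total 0 x) => [/wh//|x0].
  by have := wh (- x); rewrite sinN !normrN oppr_ge0; exact.
have [|c _] := @MVT_segment R sin cos 0 x x0 (fun y _ => is_derive_sin y).
  exact/continuous_subspaceT/continuous_sin.
by rewrite sin0 !subr0 => ->; rewrite normrM ler_piMl // cos_max.
Qed.

Lemma onemcosE x : 1 - cos x = 2 * sin (x / 2) ^+ 2.
Proof. by rewrite {1}[x]splitr -mulr2n cos_mulr2n sin2cos2; ring. Qed.

Lemma onemcos_ge0 x : 0 <= 1 - cos x.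
Proof. by rewrite subr_ge0 cos_le1. Qed.

Lemma onemcos_le2 x : 1 - cos x <= 2.
Proof. by have := cos_geN1 x; lra. Qed.

Lemma onemcos_le_norm x : 1 - cos x <= `|x|.
Proof.
have h := ler_norm_sin (x / 2); have s1 := sin_max (x / 2).
rewrite onemcosE -(@real_normK _ (sin _)) ?num_real //.
move: h s1; rewrite normrM [`|2^-1|]ger0_norm //.
by have := normr_ge0 (sin (x / 2)); nra.
Qed.

Lemma onemcos_le_sqr x : 1 - cos x <= x ^+ 2.
Proof.
rewrite onemcosE; have := ler_norm_sin (x / 2).
rewrite -(@ler_pXn2r _ 2) ?nnegrE // -!normrX !ger0_norm ?sqr_ge0 // => h.
have := sqr_ge0 x; nra.
Qed.

(** The difference sin x - x cos x vanishes at 0 and has derivative x sin x. *)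
Lemma mulr_cos_le_sin x : 0 <= x <= pi / 2 -> x * cos x <= sin x.
Proof.
move=> /andP[x0 xpi]; rewrite -subr_ge0.
pose f y : R := sin y - y * cos y.
have df (y : R) : is_derive y 1 f (y * sin y).
  by apply: is_derive_eq; rewrite /GRing.scale /=; ring.
have [|c] := @MVT_segment R f (fun y => y * sin y) 0 x x0 (fun y _ => df y).
  apply: continuous_subspaceT => y.
  by apply: differentiable_continuous; apply/derivable1_diffP; have [] := df y.
rewrite in_itv /= /f sin0 !mul0r !subr0 => /andP[c0 cx] ->.
rewrite mulr_ge0 // mulr_ge0 //; apply: sin_ge0_pi; rewrite c0 /=.
by have := pi_ge0 R; lra.
Qed.

Lemma continuous_sinMl (w : R) : continuous (fun x : R => sin (w * x)).
Proof.
move=> x; apply: (@continuous_comp _ _ _ ( *%R w) sin); last exact: continuous_sin.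
by apply: cvgM; [exact: cvg_cst|exact: cvg_id].
Qed.

Lemma continuous_cosMl (w : R) : continuous (fun x : R => cos (w * x)).
Proof.
move=> x; apply: (@continuous_comp _ _ _ ( *%R w) cos); last exact: continuous_cos.
by apply: cvgM; [exact: cvg_cst|exact: cvg_id].
Qed.

End TrigonometricBounds.

(** * Integrals depending on a parameter *)

Section UnderIntegral.
Variables (R : realType) (d : measure_display) (T : measurableType d).
Variables (mu : {measure set T -> \bar R}) (D : set T).
Hypothesis mD : measurable D.

Lemma integrable_mul_bounded (q k : T -> R) (C : R) :
  mu.-integrable D (EFin \o q) -> measurable_fun D k ->
  (forall x, D x -> `|k x| <= C) ->
  mu.-integrable D (EFin \o (fun x => q x * k x)).
Proof.
move=> iq mk kC.
have -> : EFin \o (fun x => q x * k x) = ((EFin \o q) \* (EFin \o k))%E.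
  by apply/funext => x /=; rewrite EFinM.
apply: integrableMl => //; exists C; split; first exact: num_real.
by move=> M CM x Dx; apply: le_trans (kC _ Dx) _; exact: ltW.
Qed.

Lemma Rintegral_mul_bounded_le (q k : T -> R) (C : R) :
  mu.-integrable D (EFin \o q) -> measurable_fun D k ->
  (forall x, D x -> `|k x| <= C) ->
  `|\int[mu]_(x in D) (q x * k x)| <= C * \int[mu]_(x in D) `|q x|.
Proof.
move=> iq mk kC; have iqk := integrable_mul_bounded iq mk kC.
apply: le_trans (le_normr_Rintegral mD iqk) _.
rewrite -RintegralZl //; last exact: integrable_norm.
apply: le_Rintegral => //.
- exact: integrable_norm iqk.
- rewrite (_ : _ \o _ = fun x => (C%:E * (EFin \o (Num.norm \o q)) x)%E) //.
  by apply: integrableZl => //; exact: integrable_norm.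
- by move=> x Dx; rewrite normrM mulrC ler_wpM2r // kC.
Qed.

(** The bound B v only serves integrability, the bound C dominates the
    derivative near w. *)
Lemma is_derive_under_integral (q : T -> R) (k k' : R -> T -> R) (B : R -> R)
    (C w : R) :
  mu.-integrable D (EFin \o q) ->
  (forall v, measurable_fun D (k v)) ->
  (forall v x, D x -> `|k v x| <= B v) ->
  (forall (v : R) x, D x -> is_derive v 1 (k ^~ x : R -> R) (k' v x)) ->
  (forall v x, `|v - w| < 1 -> D x -> `|k' v x| <= C) ->
  is_derive w 1 (fun v : R => \int[mu]_(x in D) (q x * k v x) : R)
    (\int[mu]_(x in D) (q x * k' w x)).
Proof.
move=> iq mk kB dk k'C.
pose f v x := q x * k v x.
have df (v : R) x : D x -> is_derive v 1 (f ^~ x : R -> R) (q x * k' v x).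
  by move=> Dx; have := dk v x Dx => ?; apply: is_derive_eq.
have pf v x : D x -> partial1of2 f v x = q x * k' v x.
  by move=> Dx; rewrite partial1of2E; have := df v x Dx => ?; exact: derive_val.
have Iw : `](w - 1), (w + 1)[%classic w by rewrite /= in_itv /=; apply/andP; split; lra.
have intf v : `](w - 1), (w + 1)[%classic v -> mu.-integrable D (EFin \o f v).
  by move=> _; exact: integrable_mul_bounded iq (mk v) (kB v).
have derf v x : `](w - 1), (w + 1)[%classic v -> D x -> derivable (f ^~ x) v 1.
  by move=> _ Dx; have [] := df v x Dx.
pose G x := `|C| * `|q x|.
have G0 x : 0 <= G x by rewrite mulr_ge0.
have iG : mu.-integrable D (EFin \o G).
  rewrite (_ : _ \o _ = fun x => (`|C|%:E * (EFin \o (Num.norm \o q)) x)%E) //.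
  by apply: integrableZl => //; exact: integrable_norm.
have Gub v x : `](w - 1), (w + 1)[%classic v -> D x -> `|partial1of2 f v x| <= G x.
  rewrite /= in_itv /= => /andP[v1 v2] Dx; rewrite pf // normrM mulrC ler_wpM2r //.
  by rewrite (le_trans _ (ler_norm C)) // k'C // ltr_norml; apply/andP; split; lra.
have D1 := derivable_under_integral mD Iw intf derf G0 iG Gub.
have D2 := differentiation_under_integral mD Iw intf derf G0 iG Gub.
apply: DeriveDef; first exact: D1.
rewrite -derive1E [LHS]D2; apply: eq_Rintegral => x; rewrite inE => Dx.
exact: pf.
Qed.

Lemma continuous_under_integral (q : T -> R) (k : R -> T -> R) (C : R) :
  mu.-integrable D (EFin \o q) ->
  (forall v, measurable_fun D (k v)) ->
  (forall v x, D x -> `|k v x| <= C) ->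
  (forall x, D x -> continuous (k ^~ x)) ->
  continuous (fun v => \int[mu]_(x in D) (q x * k v x)).
Proof.
move=> iq mk kC ck w.
pose f v x := q x * k v x.
pose G x := `|C| * `|q x|.
have iG : mu.-integrable D (EFin \o G).
  rewrite (_ : _ \o _ = fun x => (`|C|%:E * (EFin \o (Num.norm \o q)) x)%E) //.
  by apply: integrableZl => //; exact: integrable_norm.
have intf v : `](w - 1), (w + 1)[%classic v -> mu.-integrable D (EFin \o f v).
  by move=> _; exact: integrable_mul_bounded iq (mk v) (kC v).
have cf : {ae mu, forall y, D y -> {in `](w - 1), (w + 1)[%classic, continuous (f ^~ y)}}.
  by apply: aeW => x Dx v _; apply: cvgM; [exact: cvg_cst|exact: ck].
have Gub v : `](w - 1), (w + 1)[%classic v -> {ae mu, forall y, D y -> `|f v y| <= G y}.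
  move=> _; apply: aeW => x Dx; rewrite normrM mulrC ler_wpM2r //.
  by rewrite (le_trans _ (ler_norm C)) // kC.
apply: (continuity_under_integral mD intf cf iG Gub).
by rewrite inE /= in_itv /=; apply/andP; split; lra.
Qed.

End UnderIntegral.

(** * The fundamental theorem of calculus *)

Section FundamentalTheorem.
Variable R : realType.
Local Notation mu := (leb : {measure set (lebT R) -> \bar R}).

Lemma leb_measurable_itv (i : interval R) : measurable ([set` i] : set (lebT R)).
Proof. by apply: leb_measurable_set; exact: measurable_itv. Qed.

Lemma continuous_leb_measurable (D : set (lebT R)) (a : R -> R) : continuous a ->
  measurable_fun D (a : lebT R -> R).
Proof. by move=> ca; apply: leb_measurable_fun; exact: continuous_measurable_fun. Qed.

Lemma continuous_leb_integrable (a : R -> R) (x y : R) : continuous a ->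
  mu.-integrable `[x, y] (EFin \o a).
Proof.
move=> ca; apply: integrable_leb => //.
  by apply: measurable_funTS; exact: continuous_measurable_fun.
apply: continuous_compact_integrable; first exact: segment_compact.
exact: continuous_subspaceT.
Qed.

Lemma Rintegral_leb_FTC (a A : R -> R) (x y : R) : x <= y -> continuous a ->
  (forall z : R, is_derive z 1 A (a z)) ->
  \int[mu]_(z in `[x, y]) a z = A y - A x.
Proof.
move=> + ca dA; rewrite Rintegral_leb //; last first.
  by apply: measurable_funTS; exact: continuous_measurable_fun.
rewrite le_eqVlt => /predU1P[<-|xy]; first by rewrite set_itv1 subrr Rintegral_set1.
have cA : continuous A.
  by move=> z; apply: differentiable_continuous; apply/derivable1_diffP; have [] := dA z.
rewrite /Rintegral (@continuous_FTC2 _ a A) //.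
- exact: continuous_subspaceT.
- split; first by move=> z _; have [] := dA z.
    exact: cvg_at_right_filter (cA x).
  exact: cvg_at_left_filter (cA y).
- by move=> z _; rewrite derive1E; have ? := dA z; exact: derive_val.
Qed.
End FundamentalTheorem.

(** * The Riemann-Lebesgue lemma *)

Section RiemannLebesgue.
Variable R : realType.
Local Notation mu := (leb : {measure set (lebT R) -> \bar R}).

Definition bounded_measurable (g : R -> R) :=
  measurable_fun setT (g : lebT R -> R) /\ exists C, forall x, `|g x| <= C.

Lemma bounded_measurable_cst (c : R) : bounded_measurable (fun=> c).
Proof. by split; [exact: measurable_cst|exists `|c|]. Qed.

Lemma bounded_measurableD (g h : R -> R) :
  bounded_measurable g -> bounded_measurable h ->
  bounded_measurable (fun x => g x + h x).
Proof.
move=> [mg [C gC]] [mh [B hB]]; split; first exact: measurable_funD.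
by exists (C + B) => x; rewrite (le_trans (ler_normD _ _)) // lerD.
Qed.

Lemma bounded_measurableM (g h : R -> R) :
  bounded_measurable g -> bounded_measurable h ->
  bounded_measurable (fun x => g x * h x).
Proof.
move=> [mg [C gC]] [mh [B hB]]; split; first exact: measurable_funM.
by exists (C * B) => x; rewrite normrM ler_pM.
Qed.

Lemma bounded_measurable_sin (w : R) : bounded_measurable (fun x => sin (w * x)).
Proof.
split; last by exists 1 => x; exact: sin_max.
exact/continuous_leb_measurable/continuous_sinMl.
Qed.

Lemma bounded_measurable_integrable (g : R -> R) (a b : R) :
  bounded_measurable g -> mu.-integrable `[a, b] (EFin \o g).
Proof.
move=> [mg [C gC]].
have [ab|ba] := leP a b; last first.
  by rewrite set_itv_ge ?bnd_simp -?ltNge //; exact: integrable_set0.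
apply: measurable_bounded_integrable.
- exact: leb_measurable_itv.
- by rewrite leb_itv // ltry.
- exact: measurable_funTS.
- exists C; split; first exact: num_real.
  by move=> M CM x _; apply: le_trans (gC x) _; exact: ltW.
Qed.

Lemma Rintegral_cos (s M : R) : s != 0 -> 0 <= M ->
  \int[mu]_(x in `[- M, M]) cos (s * x) = 2 * sin (s * M) / s.
Proof.
move=> s0 M0.
have dA (z : R) : is_derive z 1 (fun x : R => sin (s * x) / s) (cos (s * z)).
  by apply: is_derive_eq; rewrite /GRing.scale /=; field.
rewrite (Rintegral_leb_FTC _ _ dA); last exact: continuous_cosMl.
  by rewrite mulrN sinN; field.
lra.
Qed.

Let vanishes M (g : R -> R) :=
  \int[mu]_(x in `[- M, M]) (g x * sin (w * x)) @[w --> +oo] --> (0 : R).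

(** By sin a sin b = (cos(a - b) - cos(a + b))/2 the integral is explicit and is
    of order 1/w. *)
Lemma sin_orthogonal M (v : R) : 0 <= M -> vanishes M (fun x => sin (v * x)).
Proof.
move=> M0; apply/cvgr0Pnorm_le => e e0; near=> w.
have w1 : `|v| + 2 / e <= w by near: w; apply: nbhs_pinfty_ge; exact: num_real.
have e2 : 0 < 2 / e by rewrite divr_gt0.
have bound s : 2 / e <= s -> `|2 * sin (s * M) / s| <= e.
  move=> es; have s0 : 0 < s by apply: lt_le_trans es.
  rewrite normrM normfV (gtr0_norm s0) ler_pdivrMr // normrM (gtr0_norm (ltr0n _ 2)).
  apply: le_trans (_ : 2 <= _).
    by rewrite ler_piMr // sin_max.
  by rewrite mulrC -ler_pdivrMr.
have vw : v <= `|v| /\ - v <= `|v| by rewrite ler_norm -normrN ler_norm.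
have i1 (s : R) : mu.-integrable `[- M, M] (EFin \o (fun x => cos (s * x))).
  exact/continuous_leb_integrable/continuous_cosMl.
have -> : \int[mu]_(x in `[- M, M]) (sin (v * x) * sin (w * x)) =
    (2 * sin ((w - v) * M) / (w - v) - 2 * sin ((w + v) * M) / (w + v)) * 2^-1.
  rewrite -!Rintegral_cos //; [|by lra|by lra].
  rewrite -RintegralB //; last exact: leb_measurable_itv.
  rewrite -RintegralZr //; first last.
  - apply: continuous_leb_integrable => x.
    by apply: cvgB; exact: continuous_cosMl.
  - exact: leb_measurable_itv.
  apply: eq_Rintegral => x _.
  by rewrite [(w - v) * x]mulrBl [(w + v) * x]mulrDl cosB cosD; field.
rewrite normrM [`|2^-1|]ger0_norm // ler_pdivrMr // mulr_natr mulr2n.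
rewrite (le_trans (ler_normB _ _)) // lerD //; apply: bound; lra.
Unshelve. all: by end_near.
Qed.

(** Let V be the space of bounded functions for which the claim holds on
    [-M, M]; it contains all functions sin(w x).  Take T in V whose L2 distance
    to h is nearly minimal.  Moving T by a multiple of sin(w x) stays in V and
    cannot decrease the distance by more than the defect eta, which bounds the
    coefficient of h - T at every frequency w; the coefficient of T tends
    to 0. *)
Lemma Riemann_Lebesgue_bounded M (h : R -> R) : 0 < M -> bounded_measurable h ->
  vanishes M h.
Proof.
move=> M0 bh; set I := `[(- M), M]%classic.
have mI : measurable (I : set (lebT R)) by exact: leb_measurable_itv.
pose V T := bounded_measurable T /\ vanishes M T.
pose dist2 T := \int[mu]_(x in I) ((h x - T x) * (h x - T x)).
pose E := [set dist2 T | T in V].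
have V0 : V (fun=> 0).
  split; first exact: bounded_measurable_cst.
  rewrite /vanishes; under eq_fun do under eq_Rintegral do rewrite mul0r.
  by rewrite Rintegral_cst // mul0r; exact: cvg_cst.
have bminus (g k : R -> R) : bounded_measurable g -> bounded_measurable k ->
    bounded_measurable (fun x => g x - k x).
  move=> bg bk; rewrite (_ : (fun x => _) = fun x => g x + (-1) * k x); last first.
    by apply/funext => x; rewrite mulN1r.
  have bNk := bounded_measurableM (bounded_measurable_cst (-1)) bk.
  exact: bounded_measurableD bg bNk.
have int_bm g : bounded_measurable g -> mu.-integrable I (EFin \o g).
  exact: bounded_measurable_integrable.
have infE : has_inf E.
  split; first by exists (dist2 (fun=> 0)), (fun=> 0).
  by exists 0 => _ [T _ <-]; apply: Rintegral_ge0 => x _; rewrite -expr2 sqr_ge0.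
apply/cvgr0Pnorm_le => e e0.
(* chosen so that c^2 / (2 M) <= eta forces c <= e/2 in absolute value *)
pose eta := (e / 2) ^+ 2 / (2 * M).
have eta0 : 0 < eta by rewrite divr_gt0 ?exprn_gt0 ?mulr_gt0 ?divr_gt0.
have [_ [T [bT vT] <-] Teta] := inf_adherent eta0 infE.
have near_opt w : `|\int[mu]_(x in I) ((h x - T x) * sin (w * x))| <= e / 2.
  set c := \int[mu]_(x in I) _.
  set S := \int[mu]_(x in I) (sin (w * x) * sin (w * x)).
  have bs := bounded_measurable_sin w.
  have bg := bminus _ _ bh bT.
  have S2M : S <= 2 * M.
    apply: (@le_trans _ _ (\int[mu]_(x in I) 1)).
      apply: le_Rintegral => //.
      - by apply: int_bm; exact: bounded_measurableM.
      - by apply: int_bm; exact: bounded_measurable_cst.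
    rewrite Rintegral_cst // mul1r /I leb_itv /=; lra.
  (* this multiple of sin(w x) minimises the upper bound
     dist2 T - 2 la c + 2 M la^2 for the new distance *)
  pose la := c / (2 * M).
  pose T' x := T x + la * sin (w * x).
  have bls : bounded_measurable (fun x => la * sin (w * x)).
    by apply: bounded_measurableM => //; exact: bounded_measurable_cst.
  have VT' : V T'.
    split; first exact: bounded_measurableD.
    rewrite /vanishes.
    have -> : (fun w' => \int[mu]_(x in I) (T' x * sin (w' * x))) =
        (fun w' => \int[mu]_(x in I) (T x * sin (w' * x)) +
          la * \int[mu]_(x in I) (sin (w * x) * sin (w' * x))).
      apply/funext => w'; have bs' := bounded_measurable_sin w'.
      have iss : mu.-integrable I (EFin \o (fun x => sin (w * x) * sin (w' * x))).
        by apply: int_bm; exact: bounded_measurableM.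
      rewrite -RintegralZl // -RintegralD //.
      - by apply: eq_Rintegral => x _; rewrite /T' mulrDl mulrA.
      - by apply: int_bm; exact: bounded_measurableM.
      - apply: int_bm; apply: bounded_measurableM; first exact: bounded_measurable_cst.
        exact: bounded_measurableM.
    rewrite -[0]addr0 -[X in _ + X](mulr0 la); apply: cvgD => //.
    by apply: cvgM; [exact: cvg_cst|apply: sin_orthogonal; exact: ltW].
  have : inf E <= dist2 T'.
    by apply: ge_inf; [case: infE|exists T'].
  have -> : dist2 T' = dist2 T - 2 * la * c + la ^+ 2 * S.
    have i1 : mu.-integrable I (EFin \o (fun x => (h x - T x) * (h x - T x))).
      by apply: int_bm; exact: bounded_measurableM.
    have i2 : mu.-integrable I (EFin \o (fun x => (h x - T x) * sin (w * x))).
      by apply: int_bm; exact: bounded_measurableM.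
    have i3 : mu.-integrable I (EFin \o (fun x => sin (w * x) * sin (w * x))).
      by apply: int_bm; exact: bounded_measurableM.
    have i2' : mu.-integrable I (EFin \o (fun x => 2 * la * ((h x - T x) * sin (w * x)))).
      apply: int_bm; apply: bounded_measurableM; first exact: bounded_measurable_cst.
      exact: bounded_measurableM.
    have i3' : mu.-integrable I (EFin \o (fun x => la ^+ 2 * (sin (w * x) * sin (w * x)))).
      apply: int_bm; apply: bounded_measurableM; first exact: bounded_measurable_cst.
      exact: bounded_measurableM.
    rewrite -!RintegralZl // -RintegralB // -RintegralD //.
      by apply: eq_Rintegral => x _; rewrite /T'; ring.
    apply: int_bm; apply: bminus; first exact: bounded_measurableM.
    apply: bounded_measurableM; first exact: bounded_measurable_cst.
    exact: bounded_measurableM.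
  move=> infle.
  have c2 : c ^+ 2 <= (e / 2) ^+ 2.
    have M2 : 0 < 2 * M by rewrite mulr_gt0.
    have : la ^+ 2 * S <= la ^+ 2 * (2 * M) by rewrite ler_wpM2l // sqr_ge0.
    have -> : la ^+ 2 * (2 * M) = c ^+ 2 / (2 * M).
      by rewrite /la; field; exact: lt0r_neq0.
    have : 2 * la * c = 2 * (c ^+ 2 / (2 * M)).
      by rewrite /la; field; exact: lt0r_neq0.
    move=> l1 l2; rewrite -(@ler_pM2r _ (2 * M)^-1) ?invr_gt0 // -/eta.
    by move: infle Teta; rewrite l1; move: l2; rewrite /eta; lra.
  move: c2; rewrite -[X in X <= _]real_normK ?num_real //.
  by rewrite ler_pXn2r // nnegrE; lra.
have := vT; move/cvgr0Pnorm_le => /(_ (e / 2)) /(_ ltac:(lra)).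
apply: filterS => w Tw.
rewrite (_ : \int[mu]_(x in _) _ = \int[mu]_(x in I) ((h x - T x) * sin (w * x)) +
   \int[mu]_(x in I) (T x * sin (w * x))); last first.
  rewrite -RintegralD //.
  - by apply: eq_Rintegral => x _; rewrite -mulrDl subrK.
  - apply: int_bm; apply: bounded_measurableM; first exact: bminus.
    exact: bounded_measurable_sin.
  - by apply: int_bm; exact: bounded_measurableM bT (bounded_measurable_sin w).
rewrite (le_trans (ler_normD _ _)) //.
by have := near_opt w; lra.
Qed.

End RiemannLebesgue.

Section RiemannLebesgueL1.
Variable R : realType.
Local Notation mu := (leb : {measure set (lebT R) -> \bar R}).

(** Cut f off where x or f(x) exceeds n in absolute value; dominated convergence. *)
Lemma bounded_truncation (f : R -> R) :
  mu.-integrable setT (EFin \o f) -> forall e, 0 < e ->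
  exists M g, [/\ 0 < M, bounded_measurable g, (forall x, x \notin `[- M, M] -> g x = 0),
    mu.-integrable setT (EFin \o (fun x => f x - g x)) &
    \int[mu]_x `|f x - g x| <= e].
Proof.
move=> fint e e0.
have mf : measurable_fun setT (f : lebT R -> R).
  exact/measurable_EFinP/(measurable_int _ fint).
pose A (n : nat) : set (lebT R) := `[- n%:R, n%:R] `&` [set x | `|f x| <= n%:R].
have mA n : measurable (A n).
  apply: measurableI; first exact: leb_measurable_itv.
  have mnf : measurable_fun setT (Num.norm \o (f : lebT R -> R)).
    exact: measurableT_comp.
  have -> : [set x : lebT R | `|f x| <= n%:R] =
      (Num.norm \o f) @^-1` `]-oo, n%:R]%classic.
    by apply/seteqP; split => x /=; rewrite in_itv.
  by rewrite -[X in measurable X]setTI; apply: mnf => //; exact: measurable_itv.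
pose g (n : nat) x : R := f x * \1_(A n) x.
have gE n x : g n x = if x \in A n then f x else 0.
  by rewrite /g indicE; case: (x \in A n); rewrite ?mulr1 ?mulr0.
have bg n : bounded_measurable (g n).
  split; first by apply: measurable_funM => //; exact: measurable_indic.
  exists n%:R => x; rewrite gE; case: ifPn => [|_]; last by rewrite normr0.
  by rewrite inE => -[].
have g_cvg x : (EFin \o g ^~ x) @ \oo --> (f x)%:E.
  apply: cvg_near_cst; near=> n; rewrite /= gE ifT // inE; split => /=.
    rewrite in_itv /= -ler_norml; near: n; exact: nbhs_infty_ger.
  near: n; exact: nbhs_infty_ger.
have mg n : measurable_fun setT (EFin \o (g n : lebT R -> R)).
  by apply/measurable_EFinP; have [] := bg n.
have inf : mu.-integrable setT (EFin \o (Num.norm \o f)) := integrable_norm fint.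
have int_g n : mu.-integrable setT (EFin \o g n).
  apply: le_integrable fint => // x _ /=; rewrite lee_fin gE; case: ifP => // _.
  by rewrite normr0.
have cvg_ae : {ae mu, forall x, [set: lebT R] x -> (EFin \o g ^~ x) @ \oo --> (f x)%:E}.
  by apply: aeW => x _; exact: g_cvg.
have dom_ae : {ae mu, forall x n, [set: lebT R] x ->
    (`|(EFin \o g n) x| <= (EFin \o (Num.norm \o f)) x)%E}.
  apply: aeW => x n _ /=; rewrite lee_fin gE; case: ifP => // _.
  by rewrite normr0.
have [_ + _] := dominated_convergence measurableT mg (measurable_int _ fint) cvg_ae inf dom_ae.
move/fine_cvgP => [_ /cvgr0Pnorm_le/(_ e e0) near_e].
have [n [n_e n0]] := filter_ex (filterI near_e (nbhs_infty_gt 0)).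
exists n%:R, (g n); split => //.
- by rewrite ltr0n.
- move=> x xn; rewrite gE ifF //; apply/negbTE; apply: contra xn.
  by rewrite inE => -[].
- exact: integrableB fint (int_g n).
- apply: le_trans (le_trans (ler_norm _) n_e); rewrite /Rintegral /=.
  rewrite le_eqVlt; apply/orP; left; apply/eqP; congr fine; apply: eq_integral => x _.
  by rewrite distrC.
Unshelve. all: by end_near.
Qed.

(** The error made by truncation is at most its L1 norm, whatever the frequency. *)
Lemma Riemann_Lebesgue (D : set R) (q : R -> R) : measurable (D : set (lebT R)) ->
  mu.-integrable D (EFin \o q) ->
  \int[mu]_(x in D) (q x * sin (w * x)) @[w --> +oo] --> (0 : R).
Proof.
move=> mD iq.
pose f := q \_ D.
have fint : mu.-integrable setT (EFin \o f).
  by have := (@integrable_mkcond _ _ _ mu D (EFin \o q) mD).1 iq; rewrite restrict_EFin.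
have -> : (fun w => \int[mu]_(x in D) (q x * sin (w * x))) =
          (fun w => \int[mu]_x (f x * sin (w * x))).
  apply/funext => w; rewrite Rintegral_mkcond; apply: eq_Rintegral => x _.
  by rewrite /f !patchE; case: ifP; rewrite ?mul0r.
apply/cvgr0Pnorm_le => e e0.
have [M [g [M0 bg g0 ifg fg]]] := bounded_truncation fint (ltac:(lra) : 0 < e / 2).
have := Riemann_Lebesgue_bounded M0 bg; move/cvgr0Pnorm_le => /(_ (e / 2) ltac:(lra)).
apply: filterS => w gw.
have msin : measurable_fun setT ((fun x => sin (w * x)) : lebT R -> R).
  by case: (bounded_measurable_sin w).
have sin1 x : [set: R] x -> `|sin (w * x)| <= 1 by move=> _; exact: sin_max.
have ifs := integrable_mul_bounded measurableT ifg msin sin1.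
have gI : \int[mu]_(x in `[- M, M]) (g x * sin (w * x)) = \int[mu]_x (g x * sin (w * x)).
  rewrite Rintegral_mkcond; apply: eq_Rintegral => x _; rewrite patchE.
  by case: ifPn => //; rewrite notin_setE => /negP/g0 ->; rewrite mul0r.
have igs : mu.-integrable setT (EFin \o (fun x => g x * sin (w * x))).
  have ig : mu.-integrable setT (EFin \o g).
    rewrite (_ : EFin \o g = (EFin \o f) \- (EFin \o (fun x => (f x - g x)%R)))%E.
      exact: integrableB.
    by apply/funext => x /=; rewrite -EFinB opprB addrC subrK.
  exact: integrable_mul_bounded ig msin sin1.
have -> : \int[mu]_x (f x * sin (w * x)) =
  \int[mu]_x ((f x - g x) * sin (w * x)) + \int[mu]_x (g x * sin (w * x)).
  by rewrite -RintegralD //; apply: eq_Rintegral => x _; rewrite -mulrDl subrK.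
have := Rintegral_mul_bounded_le measurableT ifg msin sin1.
rewrite mul1r -gI => h; rewrite (le_trans (ler_normD _ _)) // [leRHS]splitr lerD //.
exact: le_trans fg.
Qed.
End RiemannLebesgueL1.

(** * The Dirichlet integral *)

Section DirichletIntegral.
Variable R : realType.
Local Notation mu := (leb : {measure set (lebT R) -> \bar R}).

Lemma measurable_inv : measurable_fun [set: R] (fun x : R => x^-1).
Proof.
rewrite (_ : setT = [set 0] `|` [set r : R | r != 0]); last first.
  by apply/seteqP; split=> // x _; case: (eqVneq x 0) => x0; [left|right].
have oU : open [set r : R | r != 0] by [].
apply/measurable_funU; [exact: measurable_set1|exact: open_measurable|split].
  exact: measurable_fun_set1.
apply: open_continuous_measurable_fun => //.
by apply/in_setP => x /= x0; exact: inv_continuous.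
Qed.

Lemma leb_measurable_inv (D : set (lebT R)) :
  measurable_fun D ((fun x : R => x^-1) : lebT R -> R).
Proof. by apply: leb_measurable_fun; exact: measurable_inv. Qed.

Lemma leb_measurable_sin (D : set (lebT R)) (w : R) :
  measurable_fun D ((fun x : R => sin (w * x)) : lebT R -> R).
Proof. exact/continuous_leb_measurable/continuous_sinMl. Qed.

Lemma leb_measurable_cos (D : set (lebT R)) (w : R) :
  measurable_fun D ((fun x : R => cos (w * x)) : lebT R -> R).
Proof. exact/continuous_leb_measurable/continuous_cosMl. Qed.

Lemma leb_measurable_sinc (D : set (lebT R)) (w : R) :
  measurable_fun D ((fun x : R => sin (w * x) / x) : lebT R -> R).
Proof. by apply: measurable_funM; [exact: leb_measurable_sin|exact: leb_measurable_inv]. Qed.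

Lemma sinc_bound (w x : R) : `|sin (w * x) / x| <= `|w|.
Proof.
have [->|x0] := eqVneq x 0; first by rewrite invr0 mulr0 normr0.
rewrite normrM normfV ler_pdivrMr ?normr_gt0 // (le_trans (ler_norm_sin _)) //.
by rewrite normrM.
Qed.

Lemma is_derive_sinc (x w : R) : x != 0 ->
  is_derive w 1 (fun v : R => sin (v * x) / x) (cos (w * x)).
Proof. by move=> x0; apply: is_derive_eq; rewrite /GRing.scale /=; field. Qed.

Lemma leb_integrable_cst (a b c : R) (x y : bool) : 
  mu.-integrable [set` Interval (BSide x a) (BSide y b)] (EFin \o fun=> c).
Proof.
apply: (@integrableS _ _ _ mu `[a, b]); try exact: leb_measurable_itv.
  by case: x; case: y => z /=; rewrite !in_itv /= => /andP[? ?]; apply/andP; split; lra.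
exact: bounded_measurable_integrable (bounded_measurable_cst c).
Qed.

Lemma Rintegral_leb_split (x y z : itv_bound R) (g : R -> R) :
  (x <= y)%O -> (y <= z)%O ->
  mu.-integrable [set` Interval x z] (EFin \o g) ->
  \int[mu]_(u in [set` Interval x z]) g u =
  \int[mu]_(u in [set` Interval x y]) g u + \int[mu]_(u in [set` Interval y z]) g u.
Proof.
move=> xy yz ig; rewrite (itv_bndbnd_setU xy yz) in ig *; rewrite Rintegral_setU //.
- exact: leb_measurable_itv.
- exact: leb_measurable_itv.
- apply/disj_setPS => u [] /=; rewrite !itv_boundlr => /andP[_ uy] /andP[yu _].
  by have := le_trans uy yu; rewrite bnd_simp ltxx.
Qed.

Lemma Rintegral_leb_obnd (g : R -> R) (a : R) (z : itv_bound R) :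
  (BRight a <= z)%O -> mu.-integrable [set` Interval (BLeft a) z] (EFin \o g) ->
  \int[mu]_(x in [set` Interval (BRight a) z]) g x =
  \int[mu]_(x in [set` Interval (BLeft a) z]) g x.
Proof.
move=> az ig; rewrite (@Rintegral_leb_split (BLeft a) (BRight a) z) ?bnd_simp //.
have ma : measurable (`[a, a] : set (lebT R)) by exact: leb_measurable_itv.
have mg : measurable_fun (`[a, a] : set (lebT R)) (EFin \o g).
  apply: (measurable_funS _ _ (measurable_int _ ig)); first exact: leb_measurable_itv.
  by apply: subset_itvl.
have a0 : mu `[a, a]%classic = 0%E by rewrite leb_itv // subrr.
have /(congr1 fine) := @null_set_integral _ _ _ mu _ _ ma mg a0.
rewrite -[LHS]/(\int[mu]_(x in [set` Interval (BLeft a) (BRight a)]) g x) => ->.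
by rewrite add0r.
Qed.

Lemma Rintegral_leb_oc (g : R -> R) (a b : R) : a <= b ->
  mu.-integrable `[a, b] (EFin \o g) ->
  \int[mu]_(x in `]a, b]) g x = \int[mu]_(x in `[a, b]) g x.
Proof. by move=> ab ig; rewrite Rintegral_leb_obnd // bnd_simp. Qed.

(** sin((2n+1)x)/sin x, written as a trigonometric sum to be defined at 0. *)
Definition dirichlet_kernel (n : nat) (x : R) : R :=
  1 + \sum_(k < n) 2 * cos (2 * k.+1%:R * x).

Lemma dirichlet_kernelE n x : dirichlet_kernel n x * sin x = sin ((2 * n%:R + 1) * x).
Proof.
elim: n => [|n IH]; first by rewrite /dirichlet_kernel big_ord0 addr0 mulr0 add0r !mul1r.
rewrite /dirichlet_kernel big_ord_recr /= addrA mulrDl IH.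
set y := 2 * n.+1%:R * x.
have -> : (2 * n%:R + 1) * x = y - x by rewrite /y -natr1; ring.
have -> : (2 * n.+1%:R + 1) * x = y + x by rewrite /y; ring.
by rewrite sinB sinD; ring.
Qed.

Lemma continuous_dirichlet_kernel n : continuous (dirichlet_kernel n).
Proof.
elim: n => [|n IH] x.
  rewrite (_ : dirichlet_kernel 0 = fun=> 1); first exact: cvg_cst.
  by apply/funext => y; rewrite /dirichlet_kernel big_ord0 addr0.
rewrite (_ : dirichlet_kernel n.+1 =
  fun x => dirichlet_kernel n x + 2 * cos (2 * n.+1%:R * x)).
  apply: cvgD; first exact: IH.
  by apply: cvgM; [exact: cvg_cst|exact: continuous_cosMl].
by apply/funext => y; rewrite /dirichlet_kernel big_ord_recr /= addrA.
Qed.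

Lemma sin_natpi (n : nat) : sin (pi *+ n) = 0 :> R.
Proof. by rewrite -[_ *+ _]add0r (alternatingn (@sinDpi R)) sin0 mulr0. Qed.

(** Over [0, pi/2] every cosine of the sum integrates to 0. *)
Lemma Rintegral_dirichlet_kernel n :
  \int[mu]_(x in `[0, pi / 2]) dirichlet_kernel n x = pi / 2.
Proof.
have pi2 : 0 <= pi / 2 :> R by rewrite divr_ge0 // pi_ge0.
elim: n => [|n IH].
  under eq_Rintegral do rewrite /dirichlet_kernel big_ord0 addr0.
  by rewrite Rintegral_cst ?leb_itv //= ?mul1r ?subr0 //; exact: leb_measurable_itv.
under eq_Rintegral do rewrite /dirichlet_kernel big_ord_recr /= addrA -/(dirichlet_kernel n _).
have s0 : (2 * n.+1%:R : R) != 0 by rewrite mulf_neq0 // pnatr_eq0.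
have dA (z : R) : is_derive z 1 (fun x : R => 2 * sin (2 * n.+1%:R * x) / (2 * n.+1%:R))
    (2 * cos (2 * n.+1%:R * z)).
  by apply: is_derive_eq; rewrite /GRing.scale /=; move: (2 * n.+1%:R : R) s0 => m m0; field.
have cc : continuous (fun x : R => 2 * cos (2 * n.+1%:R * x)).
  by move=> x; apply: cvgM; [exact: cvg_cst|exact: continuous_cosMl].
rewrite RintegralD; first last.
- exact: continuous_leb_integrable.
- apply: continuous_leb_integrable; exact: continuous_dirichlet_kernel.
- exact: leb_measurable_itv.
rewrite IH (Rintegral_leb_FTC pi2 cc dA) mulr0 sin0.
have -> : 2 * n.+1%:R * (pi / 2) = pi *+ n.+1 :> R by rewrite -mulr_natl; field.
by rewrite sin_natpi !mulr0 !mul0r subrr addr0.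
Qed.

(** From x cos x <= sin x one gets x - sin x <= x (1 - cos x), and
    1 - cos x <= sin x because both lie in [0, 1] and
    sin^2 x = (1 - cos x) (1 + cos x). *)
Lemma cosec_sub_inv_bound (x : R) : 0 < x <= pi / 2 -> `|(sin x)^-1 - x^-1| <= 1.
Proof.
move=> /andP[x0 xpi].
have s0 : 0 < sin x by apply: sin_gt0_pi; have := pi_gt0 R; lra.
have sx : sin x <= x.
  by have := ler_norm_sin x; rewrite (gtr0_norm x0); apply: le_trans; exact: ler_norm.
have xc : x * cos x <= sin x by apply: mulr_cos_le_sin; rewrite ltW.
have c0 : 0 <= cos x by apply: cos_ge0_pihalf; have := pi_gt0 R; lra.
have c1 := cos_le1 x. have s1 := sin_le1 x. have cs := cos2Dsin2 x.
rewrite ger0_norm; last by rewrite subr_ge0 lef_pV2 ?posrE.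
rewrite (_ : _ - _ = (x - sin x) / (x * sin x)); last by field; rewrite !gt_eqF.
rewrite ler_pdivrMr ?mulr_gt0 // mul1r.
apply: (@le_trans _ _ (x * (1 - cos x))); first lra.
rewrite ler_pM2l //; nra.
Qed.

Lemma integrable_cosec_sub_inv :
  mu.-integrable `]0, pi / 2] (EFin \o (fun x : R => (sin x)^-1 - x^-1)).
Proof.
rewrite (_ : (fun x => _) = fun x : R => 1 * ((sin x)^-1 - x^-1)); last first.
  by apply/funext => x; rewrite mul1r.
apply: (@integrable_mul_bounded _ _ _ _ _ _ _ _ 1).
- exact: leb_measurable_itv.
- exact: leb_integrable_cst.
- apply: measurable_funB; last exact: leb_measurable_inv.
  apply: leb_measurable_fun; apply: measurableT_comp measurable_inv _.
  by apply: continuous_measurable_fun; exact: continuous_sin.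
- by move=> x /=; rewrite in_itv /= => xD; exact: cosec_sub_inv_bound.
Qed.

(** Replacing 1/x by 1/sin x makes the integral exactly pi/2; the difference of
    the two is bounded, so the Riemann-Lebesgue lemma applies to the error. *)
Lemma dirichlet_odd n :
  \int[mu]_(x in `]0, pi / 2]) (sin ((2 * n%:R + 1) * x) / x) =
  pi / 2 - \int[mu]_(x in `]0, pi / 2]) (((sin x)^-1 - x^-1) * sin ((2 * n%:R + 1) * x)).
Proof.
set w := 2 * n%:R + 1.
have mD : measurable (`]0, pi / 2] : set (lebT R)) by exact: leb_measurable_itv.
have iP : mu.-integrable `[0, pi / 2] (EFin \o dirichlet_kernel n).
  by apply: continuous_leb_integrable; exact: continuous_dirichlet_kernel.
have iP' : mu.-integrable `]0, pi / 2] (EFin \o dirichlet_kernel n).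
  apply: (integrableS _ _ _ iP) => //; first exact: leb_measurable_itv.
  by move=> z /=; rewrite !in_itv /= => /andP[? ?]; apply/andP; split; lra.
rewrite -[X in _ = X - _](Rintegral_dirichlet_kernel n) -Rintegral_leb_oc //; last by rewrite divr_ge0 // pi_ge0.
rewrite -RintegralB //.
- apply: eq_Rintegral => x; rewrite inE /= in_itv /= => /andP[x0 xpi].
  have s0 : 0 < sin x by apply: sin_gt0_pi; have := pi_gt0 R; lra.
  rewrite -dirichlet_kernelE; field.
  by rewrite !gt_eqF.
- apply: (@integrable_mul_bounded _ _ _ mu _ mD _ _ 1 integrable_cosec_sub_inv).
    exact: leb_measurable_sin.
  by move=> x _; exact: sin_max.
Qed.

Lemma is_derive_dirichlet (a w : R) : 0 < a -> w != 0 ->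
  is_derive w 1 (fun v : R => \int[mu]_(x in `]0, a]) (sin (v * x) / x))
    (sin (w * a) / w).
Proof.
move=> a0 w0; have mD : measurable (`]0, a] : set (lebT R)) by exact: leb_measurable_itv.
have ic : mu.-integrable `]0, a] (EFin \o fun=> (1 : R)) by exact: leb_integrable_cst.
have dk (v x : R) : `]0, a]%classic x ->
    is_derive v 1 ((fun v x : R => sin (v * x) / x) ^~ x : R -> R) (cos (v * x)).
  by rewrite /= in_itv /= => /andP[x0 _]; apply: is_derive_sinc; rewrite gt_eqF.
have cos1 (v x : R) : `|v - w| < 1 -> `]0, a]%classic x -> `|cos (v * x)| <= 1.
  by move=> _ _; exact: cos_max.
have := is_derive_under_integral mD ic (@leb_measurable_sinc _)
  (fun v x _ => sinc_bound v x) dk cos1.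
have -> : (fun v : R => \int[mu]_(x in `]0, a]) (1 * (sin (v * x) / x))) =
    (fun v : R => \int[mu]_(x in `]0, a]) (sin (v * x) / x)).
  by apply/funext => v; under eq_Rintegral do rewrite mul1r.
suff -> : \int[mu]_(x in `]0, a]) (1 * cos (w * x)) = sin (w * a) / w by [].
under eq_Rintegral do rewrite mul1r.
have icos : mu.-integrable `[0, a] (EFin \o (fun x => cos (w * x))).
  exact/continuous_leb_integrable/continuous_cosMl.
rewrite Rintegral_leb_oc // ?ltW //.
have dA (z : R) : is_derive z 1 (fun x : R => sin (w * x) / w) (cos (w * z)).
  by apply: is_derive_eq; rewrite /GRing.scale /=; field.
rewrite (Rintegral_leb_FTC _ _ dA); [|exact: ltW|exact: continuous_cosMl].
by rewrite mulr0 sin0 mul0r subr0.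
Qed.

(** The odd integers give pi/2 by the previous identity.  Between them the
    integral varies little, as its derivative in w is at most 1/w. *)
Lemma dirichlet_cvg_pihalf :
  \int[mu]_(x in `]0, pi / 2]) (sin (w * x) / x) @[w --> +oo] --> (pi / 2 : R).
Proof.
set F := fun w : R => \int[mu]_(x in `]0, pi / 2]) (sin (w * x) / x).
have pi2 : 0 < pi / 2 :> R by rewrite divr_gt0 // pi_gt0.
apply/cvgrPdist_le => e e0.
have mD : measurable (`]0, pi / 2] : set (lebT R)) by exact: leb_measurable_itv.
have := Riemann_Lebesgue mD integrable_cosec_sub_inv.
move/cvgr0Pnorm_le => /(_ (e / 2) ltac:(lra)) [B [_ RL]].
near=> w.
have wB : `|B| + 4 / e + 3 < w by near: w; apply: nbhs_pinfty_gt; exact: num_real.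
have e4 : 0 < 4 / e by rewrite divr_gt0.
have B0 := normr_ge0 B; have BB := ler_norm B.
(* 2 n + 1 is the last odd integer up to w *)
pose n := Num.truncn ((w - 1) / 2).
have /andP[n1 n2] : n%:R <= (w - 1) / 2 < n.+1%:R by apply: truncn_itv; lra.
set v : R := 2 * n%:R + 1.
have vw : v <= w <= v + 2.
  by move: n2; rewrite /v -(natr1 n); lra.
have ve : 4 / e < v by lra.
have v0 : 0 < v by lra.
have Fv : `|pi / 2 - F v| <= e / 2.
  by rewrite /F dirichlet_odd opprB addrC subrK; apply: RL; lra.
have Fw : `|F w - F v| <= e / 2.
  have dF (z : R) : z \in `]v, w[ -> is_derive z 1 F (sin (z * (pi / 2)) / z).
    by rewrite in_itv /= => /andP[vz _]; apply: is_derive_dirichlet => //; rewrite gt_eqF // (lt_trans v0).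
  have cF : {within `[v, w], continuous F}.
    apply: continuous_in_subspaceT => z; rewrite inE /= in_itv /= => /andP[vz _].
    have z0 : z != 0 by rewrite gt_eqF // (lt_le_trans v0).
    apply: differentiable_continuous; apply/derivable1_diffP.
    by have [] := is_derive_dirichlet pi2 z0.
  have [|c + ->] := MVT_segment _ dF cF; first lra.
  rewrite in_itv /= => /andP[vc cw].
  have c0 : 0 < c by lra.
  rewrite !normrM normfV (gtr0_norm c0).
  have sc0 : 0 <= `|sin (c * (pi / 2))| / c by rewrite divr_ge0 // ltW.
  have sc : `|sin (c * (pi / 2))| / c <= 1 / v.
    by apply: ler_pM; rewrite ?sin_max ?invr_ge0 ?lef_pV2 ?posrE ?(ltW c0).
  have cv : `|w - v| <= 2.
    by case/andP: vw => vw1 vw2; rewrite ger0_norm ?lerBlDl ?subr_ge0.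
  apply: (@le_trans _ _ (1 / v * 2)); first exact: ler_pM.
  rewrite mul1r mulrC ler_pdivrMr //; move: ve; rewrite ltr_pdivrMr //; lra.
rewrite (_ : pi / 2 - F w = (pi / 2 - F v) - (F w - F v)); last by ring.
by rewrite (le_trans (ler_normB _ _)) // [leRHS]splitr lerD.
Unshelve. all: by end_near.
Qed.

Lemma cvg_ext (F : set_system R) (f g : R -> R) (l : R) :
  f =1 g -> f x @[x --> F] --> l -> g x @[x --> F] --> l.
Proof. by move=> /funext ->. Qed.

(** On ]a, b] the factor 1/x is integrable, so this is Riemann-Lebesgue. *)
Lemma dirichlet_cvg_sub (a b : R) : 0 < a -> a <= b ->
  \int[mu]_(x in `]0, b]) (sin (w * x) / x) -
  \int[mu]_(x in `]0, a]) (sin (w * x) / x) @[w --> +oo] --> (0 : R).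
Proof.
move=> a0 ab.
have mD : measurable (`]a, b] : set (lebT R)) by exact: leb_measurable_itv.
have mD' : measurable (`]0, b] : set (lebT R)) by exact: leb_measurable_itv.
have ic : mu.-integrable `]a, b] (EFin \o (fun x => 1 * x^-1)).
  apply: (@integrable_mul_bounded _ _ _ mu _ mD _ _ a^-1).
  - exact: leb_integrable_cst.
  - exact: leb_measurable_inv.
  - move=> x /=; rewrite in_itv /= => /andP[ax _].
    by rewrite ger0_norm ?invr_ge0 ?lef_pV2 ?posrE //; lra.
apply: cvg_ext (Riemann_Lebesgue mD ic) => w.
have is1 : mu.-integrable `]0, b] (EFin \o (fun x => sin (w * x) / x)).
  rewrite (_ : (fun x => _) = (fun x => 1 * (sin (w * x) / x))); last first.
    by apply/funext => x; rewrite mul1r.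
  apply: (@integrable_mul_bounded _ _ _ mu _ mD' _ _ `|w|).
  - exact: leb_integrable_cst.
  - exact: leb_measurable_sinc.
  - by move=> x _; exact: sinc_bound.
rewrite (@Rintegral_leb_split (BRight 0) (BRight a) (BRight b)) ?bnd_simp ?(ltW a0) //.
by rewrite [RHS]addrAC subrr add0r; apply: eq_Rintegral => x _; rewrite mul1r mulrC.
Qed.

Lemma dirichlet_cvg (a : R) : 0 < a ->
  \int[mu]_(x in `]0, a]) (sin (w * x) / x) @[w --> +oo] --> (pi / 2 : R).
Proof.
move=> a0; have pi2 : 0 < pi / 2 :> R by rewrite divr_gt0 // pi_gt0.
have [ap|pa] := leP a (pi / 2).
  have := cvgB dirichlet_cvg_pihalf (dirichlet_cvg_sub a0 ap).
  by rewrite subr0 => h; apply: cvg_ext (h _) => w /=; rewrite opprB addrC subrK.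
have := cvgD dirichlet_cvg_pihalf (dirichlet_cvg_sub pi2 (ltW pa)).
by rewrite addr0 => h; apply: cvg_ext (h _) => w /=; rewrite addrC subrK.
Qed.

End DirichletIntegral.

(** * Partial integrals of cosine and sine transforms *)

Section PartialFourierIntegrals.
Variable R : realType.
Local Notation mu := (leb : {measure set (lebT R) -> \bar R}).
Local Notation D := (`]0, +oo[%classic : set (lebT R)).
Variable q : R -> R.
Hypothesis iq : mu.-integrable D (EFin \o q).

Let mD : measurable D. Proof. exact: leb_measurable_itv. Qed.
Let D_neq0 (x : R) : D x -> x != 0.
Proof. by rewrite /= in_itv /= andbT => x0; rewrite gt_eqF. Qed.

Let cosine_transform (w : R) := \int[mu]_(x in D) (q x * cos (w * x)).
Let sine_transform (w : R) := \int[mu]_(x in D) (q x * sin (w * x)).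

Lemma continuous_cosine_transform : continuous cosine_transform.
Proof.
apply: (@continuous_under_integral _ _ _ mu _ mD _ (fun w x => cos (w * x)) 1 iq).
- by move=> v; exact: leb_measurable_cos.
- by move=> v x _; exact: cos_max.
- move=> x _ w.
  by under [X in continuous_at w X]eq_fun do rewrite mulrC; exact: continuous_cosMl.
Qed.

Lemma continuous_sine_transform : continuous sine_transform.
Proof.
apply: (@continuous_under_integral _ _ _ mu _ mD _ (fun w x => sin (w * x)) 1 iq).
- by move=> v; exact: leb_measurable_sin.
- by move=> v x _; exact: sin_max.
- move=> x _ w.
  by under [X in continuous_at w X]eq_fun do rewrite mulrC; exact: continuous_sinMl.
Qed.

(** The integral of q(x) sin(wx)/x is an antiderivative of the cosine transform,
    and it is odd in w. *)
Lemma Rintegral_cosine_transform (r : R) : 0 <= r ->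
  \int[mu]_(w in `[- r, r]) cosine_transform w =
  2 * \int[mu]_(x in D) (q x * (sin (r * x) / x)).
Proof.
move=> r0; pose P (w : R) := \int[mu]_(x in D) (q x * (sin (w * x) / x)).
have dP (w : R) : is_derive w 1 P (cosine_transform w).
  apply: (@is_derive_under_integral _ _ _ mu _ mD _ (fun w x => sin (w * x) / x)
    (fun w x => cos (w * x)) (fun w => `|w|) 1 _ iq).
  - by move=> v; exact: leb_measurable_sinc.
  - by move=> v x _; exact: sinc_bound.
  - by move=> v x /D_neq0; exact: is_derive_sinc.
  - by move=> v x _ _; exact: cos_max.
rewrite (Rintegral_leb_FTC _ continuous_cosine_transform dP); last by lra.
suff -> : P (- r) = - P r by rewrite opprK -mulr2n mulr_natl.
rewrite /P -[RHS]mulN1r -RintegralZl //; last first.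
  apply: (@integrable_mul_bounded _ _ _ mu _ mD _ _ `|r| iq).
    exact: leb_measurable_sinc.
  by move=> x _; exact: sinc_bound.
by apply: eq_Rintegral => x _; rewrite mulNr sinN; ring.
Qed.

(** The antiderivative with kernel (1 - cos(wx))/x is even in w. *)
Lemma Rintegral_sine_transform (r : R) : 0 <= r ->
  \int[mu]_(w in `[- r, r]) sine_transform w = 0.
Proof.
move=> r0; pose Q (w : R) := \int[mu]_(x in D) (q x * ((1 - cos (w * x)) / x)).
have dQ (w : R) : is_derive w 1 Q (sine_transform w).
  apply: (@is_derive_under_integral _ _ _ mu _ mD _ (fun w x => (1 - cos (w * x)) / x)
    (fun w x => sin (w * x)) (fun w => `|w|) 1 _ iq).
  - move=> v; apply: measurable_funM; last exact: leb_measurable_inv.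
    by apply: measurable_funB; [exact: measurable_cst|exact: leb_measurable_cos].
  - move=> v x /D_neq0 x0; rewrite normrM normfV ler_pdivrMr ?normr_gt0 //.
    by rewrite (ger0_norm (onemcos_ge0 _)) -normrM onemcos_le_norm.
  - by move=> v x /D_neq0 x0; apply: is_derive_eq; rewrite /GRing.scale /=; field.
  - by move=> v x _ _; exact: sin_max.
rewrite (Rintegral_leb_FTC _ continuous_sine_transform dQ); last by lra.
suff -> : Q (- r) = Q r by rewrite subrr.
by apply: eq_Rintegral => x _; rewrite mulNr cosN.
Qed.

End PartialFourierIntegrals.

(** * Fejer means *)

Section Fejer.
Variable R : realType.
Local Notation mu := (leb : {measure set (lebT R) -> \bar R}).

Lemma onemcos_ge (y : R) : 0 <= y <= 1 -> y ^+ 2 / 4 <= 1 - cos y.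
Proof.
move=> /andP[y0 y1].
have c : 3 / 4 <= cos (y / 2).
  by have := onemcos_le_sqr (y / 2); nra.
have s : y / 2 * (3 / 4) <= sin (y / 2).
  apply: le_trans (_ : y / 2 * cos (y / 2) <= _); first by rewrite ler_wpM2l //; lra.
  by apply: mulr_cos_le_sin; have := pi_ge2 R; lra.
by rewrite onemcosE; nra.
Qed.

(** With k(w, x) = (1 - cos(wx))/x^2, the integral H(w) of G k(w, .) has a
    derivative that tends to 0, so it is o(w).  If l were positive, then G >= l/2
    near 0; since k is nonnegative and at least w^2/4 on ]0, 1/w], this gives
    H(w) >= l w/8 - K, a contradiction. *)
Lemma Fejer_limit_le0 (a l : R) (G : R -> R) : 0 < a ->
  mu.-integrable `]0, a] (EFin \o G) ->
  G x @[x --> 0^'+] --> l ->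
  \int[mu]_(x in `]0, a]) (G x * (sin (w * x) / x)) @[w --> +oo] --> (0 : R) ->
  l <= 0.
Proof.
move=> a0 iG Gl S0; rewrite leNgt; apply/negP => l0.
pose k (w x : R) := (1 - cos (w * x)) / x ^+ 2.
have mk w B : measurable_fun B (k w : lebT R -> R).
  apply: measurable_funM.
    by apply: measurable_funB; [exact: measurable_cst|exact: leb_measurable_cos].
  apply: leb_measurable_fun; apply: measurableT_comp (@measurable_inv R) _.
  exact: exprn_measurable.
have k0 w x : 0 <= k w x by rewrite divr_ge0 ?sqr_ge0 ?onemcos_ge0.
have k_le w x : k w x <= w ^+ 2.
  rewrite /k; have [->|x0] := eqVneq x 0; first by rewrite expr0n /= invr0 mulr0 sqr_ge0.
  by rewrite ler_pdivrMr ?exprn_even_gt0 // -exprMn onemcos_le_sqr.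
have mD : measurable (`]0, a] : set (lebT R)) by exact: leb_measurable_itv.
pose H w := \int[mu]_(x in `]0, a]) (G x * k w x).
pose S w := \int[mu]_(x in `]0, a]) (G x * (sin (w * x) / x)).
have knorm w x : `]0, a]%classic x -> `|k w x| <= w ^+ 2.
  by move=> _; rewrite ger0_norm.
have dH (w : R) : is_derive w 1 H (S w).
  apply: (@is_derive_under_integral _ _ _ mu _ mD _ k
    (fun w x => sin (w * x) / x) (fun w => w ^+ 2) (`|w| + 1) _ iG) => //.
  - move=> v x; rewrite /= in_itv /= => /andP[x0 _].
    have xn0 : x != 0 by rewrite gt_eqF.
    by apply: is_derive_eq; rewrite /GRing.scale /=; field.
  - move=> v x vw _; apply: le_trans (sinc_bound _ _) _.
    by rewrite -lerBlDl (le_trans (lerB_dist _ _)) // ltW.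
have ikG w : mu.-integrable `]0, a] (EFin \o (fun x => G x * k w x)).
  exact: (@integrable_mul_bounded _ _ _ mu _ mD _ _ _ iG (mk w _) (knorm w)).
have [dl [dl0 dla Gdl]] : exists dl, [/\ 0 < dl, dl <= a &
    forall x, 0 < x <= dl -> l / 2 <= G x].
  move/cvgrPdist_lt : Gl => /(_ (l / 2) ltac:(lra)) [d /= d0 Gd].
  exists (Num.min (d / 2) a); split; [|by rewrite ge_min lexx orbT|].
    by rewrite lt_min a0 divr_gt0.
  move=> x /andP[x0]; rewrite le_min => /andP[xd _].
  have := Gd x; rewrite /ball /= sub0r normrN (gtr0_norm x0) => /(_ ltac:(lra) x0).
  by rewrite ltr_norml => /andP[_]; lra.
(* bounds the contribution of ]dl, a], where k(w, x) <= 2 / dl^2 *)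
pose K := 2 / dl ^+ 2 * \int[mu]_(x in `]0, a]) `|G x|.
have lower w : dl^-1 <= w -> l / 8 * w - K <= H w.
  move=> dw; have dV : 0 < dl^-1 by rewrite invr_gt0.
  have w0 : 0 < w by lra.
  have wV0 : 0 < w^-1 by rewrite invr_gt0.
  have wVdl : w^-1 <= dl by rewrite -[leRHS]invrK lef_pV2 ?posrE.
  have iabs : mu.-integrable `]0, a] (EFin \o (fun x => `|G x|)) := integrable_norm iG.
  have sub1 : `]0, w^-1] `<=` `]0, a] by apply: subset_itvl; rewrite bnd_simp (le_trans wVdl).
  have sub2 : `]w^-1, a] `<=` `]0, a] by apply: subset_itvr; rewrite bnd_simp ltW.
  have m1 : measurable (`]0, w^-1] : set (lebT R)) by exact: leb_measurable_itv.
  have m2 : measurable (`]w^-1, a] : set (lebT R)) by exact: leb_measurable_itv.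
  rewrite /H (@Rintegral_leb_split _ (BRight 0) (BRight w^-1) (BRight a)) ?bnd_simp //; first last.
  - exact: le_trans dla.
  - exact: ltW.
  apply: lerD.
    have -> : l / 8 * w = \int[mu]_(x in `]0, w^-1]) (l / 8 * w ^+ 2).
      rewrite Rintegral_cst // leb_itv /= ?ltW // subr0 expr2.
      by field; exact: lt0r_neq0.
    apply: le_Rintegral => //.
    - exact: leb_integrable_cst.
    - exact: integrableS (ikG w).
    - move=> x; rewrite /= in_itv /= => /andP[x0 xw].
      have Gx : l / 2 <= G x by apply: Gdl; rewrite x0 (le_trans xw).
      have wx : 0 <= w * x <= 1.
        apply/andP; split; first by rewrite mulr_ge0 // ltW.
        by rewrite -[leRHS](mulfV (lt0r_neq0 w0)) ler_pM2l.
      have kx : w ^+ 2 / 4 <= k w x.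
        rewrite /k ler_pdivlMr ?exprn_gt0 //.
        by move: (onemcos_ge wx); rewrite exprMn mulrAC.
      rewrite (_ : l / 8 * w ^+ 2 = l / 2 * (w ^+ 2 / 4)); last by field.
      by apply: ler_pM => //; rewrite divr_ge0 ?sqr_ge0 // ltW.
  rewrite /K (@Rintegral_leb_split _ (BRight 0) (BRight w^-1) (BRight a)) ?bnd_simp //; first last.
  - exact: le_trans dla.
  - exact: ltW.
  have K1 : 0 <= \int[mu]_(x in `]0, w^-1]) `|G x| by apply: Rintegral_ge0.
  have d2 : 0 <= 2 / dl ^+ 2 by rewrite divr_ge0 ?sqr_ge0.
  apply: (@le_trans _ _ (- (2 / dl ^+ 2) * \int[mu]_(x in `]w^-1, a]) `|G x|)).
    by rewrite mulNr lerN2 mulrDr lerDr mulr_ge0.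
  rewrite -RintegralZl //; last exact: integrableS iabs.
  apply: le_Rintegral => //.
  - rewrite (_ : _ \o _ = fun x => ((- (2 / dl ^+ 2))%:E * (EFin \o (fun x => `|G x|%R)) x)%E) //.
    by apply: integrableZl => //; exact: integrableS iabs.
  - exact: integrableS (ikG w).
  - move=> x; rewrite /= in_itv /= => /andP[xw xa].
    have x0 : 0 < x := lt_trans wV0 xw.
    have [xd|dx] := leP x dl.
      apply: (@le_trans _ _ 0); first by rewrite mulNr oppr_le0 mulr_ge0.
      by rewrite mulr_ge0 // (le_trans _ (Gdl x _)) ?x0 // divr_ge0 // ltW.
    have kx : k w x <= 2 / dl ^+ 2.
      apply: ler_pM; rewrite ?onemcos_ge0 ?invr_ge0 ?sqr_ge0 ?onemcos_le2 //.
      by rewrite lef_pV2 ?posrE ?exprn_gt0 // lerXn2r ?nnegrE ?ltW.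
    rewrite mulNr lerNl -mulNr; apply: (@le_trans _ _ (`|G x| * k w x)).
      by rewrite ler_wpM2r // -normrN ler_norm.
    by rewrite mulrC ler_wpM2r.
move/cvgr0Pnorm_le : S0 => /(_ (l / 16) ltac:(lra)) [B [_ SB]].
pose w0 := `|B| + 1.
have w0B : B < w0 by rewrite /w0; have := ler_norm B; lra.
have upper w : w0 <= w -> H w - H w0 <= l / 16 * (w - w0).
  move=> w0w; have [|c + ->] := MVT_segment w0w (fun w _ => dH w).
    apply: continuous_subspaceT => z.
    by apply: differentiable_continuous; apply/derivable1_diffP; have [] := dH z.
  rewrite in_itv /= => /andP[wc _]; rewrite ler_wpM2r ?subr_ge0 //.
  by apply: le_trans (ler_norm _) _; apply: SB; exact: lt_le_trans wc.
(* beyond both thresholds, and so large that l w/8 - K exceeds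
   H w0 + l (w - w0)/16 *)
pose w := w0 + dl^-1 + (`|K| + `|H w0|) * (16 / l) + 1.
have l16 : 0 < 16 / l by rewrite divr_gt0.
have dV : 0 < dl^-1 by rewrite invr_gt0.
have w00 : 0 <= w0 by rewrite /w0 addr_ge0.
have KH0 : 0 <= (`|K| + `|H w0|) * (16 / l) by rewrite mulr_ge0 ?addr_ge0 // ltW.
have w1 : w0 <= w by rewrite /w; lra.
have w2 : dl^-1 <= w by rewrite /w; lra.
have KHw : `|K| + `|H w0| < l / 16 * w.
  rewrite (_ : `|K| + `|H w0| = l / 16 * ((`|K| + `|H w0|) * (16 / l))); last first.
    by field; exact: lt0r_neq0.
  by rewrite ltr_pM2l ?divr_gt0 // /w ltr_pwDr // lerDr addr_ge0 // ltW.
have lw0 : 0 <= l / 16 * w0 by rewrite mulr_ge0 // ltW // divr_gt0.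
have := lower w w2; have := upper w w1.
by have := ler_norm K; have := ler_norm (H w0); move: KHw lw0; clear; lra.
Qed.

End Fejer.

(** * Inversion on the real line *)

Section PointwiseInversion.
Variable R : realType.
Local Notation mu := (leb : {measure set (lebT R) -> \bar R}).
Local Notation D := (`]0, +oo[%classic : set (lebT R)).

Lemma integrable_leb_reflections (h : R -> R) (c : R) (E : set (lebT R)) :
  measurable E -> mu.-integrable setT (EFin \o h) ->
  mu.-integrable E (EFin \o (fun u => h (c + u))) /\
  mu.-integrable E (EFin \o (fun u => h (c - u))).
Proof.
move=> mE ih.
have iso s : s * s = 1 -> mu.-integrable E (EFin \o (fun u => h (c + s * u))).
  move=> s2; have := integrable_leb_isometry c s2 measurableT ih.
  by rewrite preimage_setT; apply: integrableS.
split.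
  have := iso 1 (mulr1 1); rewrite (_ : (fun u => _) = fun u => h (c + u)) //.
  by apply/funext => u; rewrite mul1r.
have := iso (-1); rewrite mulrNN mulr1 => /(_ erefl).
rewrite (_ : (fun u => _) = fun u => h (c - u)) //.
by apply/funext => u; rewrite mulN1r.
Qed.

(** Translate by c, then reflect the negative half-line. *)
Lemma Rintegral_leb_fold (h : R -> R) (c : R) : mu.-integrable setT (EFin \o h) ->
  \int[mu]_x h x =
  \int[mu]_(u in D) h (c + u) + \int[mu]_(u in D) h (c - u).
Proof.
move=> ih.
have one2 : 1 * 1 = 1 :> R by rewrite mulr1.
have mone2 : -1 * -1 = 1 :> R by rewrite mulrNN mulr1.
rewrite (Rintegral_leb_isometry c one2 measurableT ih) preimage_setT.
have ihc := integrable_leb_isometry c one2 measurableT ih.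
rewrite preimage_setT in ihc.
have -> : [set: lebT R] = [set` Interval (-oo)%O (+oo)%O] :> set (lebT R) by rewrite set_itvE.
rewrite (@Rintegral_leb_split _ -oo%O (BRight 0) +oo%O) //; last by rewrite set_itvE.
rewrite addrC; congr (_ + _).
  by apply: eq_Rintegral => u _; rewrite mul1r.
have m0 : measurable (`]-oo, 0] : set (lebT R)) by exact: leb_measurable_itv.
have i0 : mu.-integrable `]-oo, 0] (EFin \o (fun x => h (c + 1 * x))).
  exact: integrableS ihc.
have i1 := integrable_leb_isometry 0 mone2 m0 i0.
rewrite (Rintegral_leb_isometry 0 mone2 m0 i0).
have E : (fun u : R => 0 + -1 * u) @^-1` `]-oo, 0] = `[0, +oo[%classic.
  by apply/seteqP; split => u /=; rewrite !in_itv /= ?andbT add0r mulN1r oppr_le0.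
rewrite E in i1 *; rewrite -Rintegral_leb_obnd //.
by apply: eq_Rintegral => u _; rewrite mul1r add0r mulN1r.
Qed.

Variables (f : R -> R) (t fr fl : R).
Hypothesis f_L1 : mu.-integrable setT (EFin \o f).

Let g u := f (t + u) + f (t - u).

Let mD : measurable D. Proof. exact: leb_measurable_itv. Qed.

Let ig (E : set (lebT R)) : measurable E -> mu.-integrable E (EFin \o g).
Proof.
move=> mE; have [i1 i2] := integrable_leb_reflections t mE f_L1.
rewrite (_ : _ \o _ = (EFin \o (fun u => f (t + u))) \+ (EFin \o (fun u => f (t - u))))%E //.
exact: integrableD.
Qed.

Lemma measurable_shift (s : R) (B : set (lebT R)) :
  measurable_fun B ((fun x : R => cos (s * (x - t))) : lebT R -> R) /\
  measurable_fun B ((fun x : R => sin (s * (x - t))) : lebT R -> R).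
Proof.
have c : continuous (fun x : R => s * (x - t)).
  by move=> x; apply: cvgM; [exact: cvg_cst|apply: cvgB; [exact: cvg_id|exact: cvg_cst]].
split; apply: continuous_leb_measurable => x.
  by apply: (@continuous_comp _ _ _ (fun x => s * (x - t)) cos) (c x) (@continuous_cos R _).
by apply: (@continuous_comp _ _ _ (fun x => s * (x - t)) sin) (c x) (@continuous_sin R _).
Qed.

Lemma integrable_fourier_cos w :
  mu.-integrable setT (EFin \o (fun x => f x * cos (w * (x - t)))).
Proof.
apply: (@integrable_mul_bounded _ _ _ mu _ measurableT _ _ 1 f_L1).
  exact: (measurable_shift w setT).1.
by move=> x _; exact: cos_max.
Qed.

Lemma integrable_fourier_sin w :
  mu.-integrable setT (EFin \o (fun x => f x * sin (w * (x - t)))).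
Proof.
apply: (@integrable_mul_bounded _ _ _ mu _ measurableT _ _ 1 f_L1).
  exact: (measurable_shift w setT).2.
by move=> x _; exact: sin_max.
Qed.

Lemma fourier_cos_fold w :
  \int[mu]_x (f x * cos (w * (x - t))) = \int[mu]_(u in D) (g u * cos (w * u)).
Proof.
have ih := integrable_fourier_cos w.
have [i1 i2] := integrable_leb_reflections t mD ih.
rewrite (Rintegral_leb_fold t ih) -RintegralD //.
apply: eq_Rintegral => u _; rewrite /g mulrDl; congr (_ * cos _ + _).
  by rewrite addrAC subrr add0r.
by rewrite addrAC subrr add0r mulrN cosN.
Qed.

Lemma fourier_sin_fold w :
  \int[mu]_x (f x * sin (w * (x - t))) =
  \int[mu]_(u in D) ((f (t + u) - f (t - u)) * sin (w * u)).
Proof.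
have ih := integrable_fourier_sin w.
have [i1 i2] := integrable_leb_reflections t mD ih.
rewrite (Rintegral_leb_fold t ih) -RintegralD //.
apply: eq_Rintegral => u _; rewrite mulrBl; congr (_ * sin _ + _).
  by rewrite addrAC subrr add0r.
by rewrite addrAC subrr add0r mulrN sinN mulrN.
Qed.

Hypothesis f_right : f x @[x --> t^'+] --> fr.
Hypothesis f_left : f x @[x --> t^'-] --> fl.
Hypothesis f_star : condition_star f t.

Let g_cvg : g u @[u --> 0^'+] --> fr + fl.
Proof.
apply: cvgD; apply/cvgrPdist_lt => e e0.
  move/cvgrPdist_lt : f_right => /(_ e e0)[d /= d0 fd]; exists d => //= u.
  rewrite /ball /= sub0r normrN => ud u0; apply: fd; rewrite /ball_ /=.
    by rewrite opprD addrA subrr sub0r normrN.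
  by rewrite ltrDl.
move/cvgrPdist_lt : f_left => /(_ e e0)[d /= d0 fd]; exists d => //= u.
rewrite /ball /= sub0r normrN => ud u0; apply: fd; rewrite /ball_ /=.
  by rewrite opprB addrC subrK.
by rewrite gtrDl oppr_lt0.
Qed.

Let g_sub_integrable (c : R) (a b : R) (x : bool) :
  mu.-integrable [set` Interval (BSide x a) (BRight b)] (EFin \o (fun u => g u - c)).
Proof.
rewrite (_ : _ \o _ = (EFin \o g) \- (EFin \o fun=> c))%E //.
apply: integrableB; first exact: leb_measurable_itv.
  by apply: ig; exact: leb_measurable_itv.
exact: leb_integrable_cst.
Qed.

Let g_sub_sinc_integrable (c a b w : R) (x : bool) :
  mu.-integrable [set` Interval (BSide x a) (BRight b)]
    (EFin \o (fun u => (g u - c) * (sin (w * u) / u))).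
Proof.
have mI : measurable ([set` Interval (BSide x a) (BRight b)] : set (lebT R)).
  exact: leb_measurable_itv.
apply: (@integrable_mul_bounded _ _ _ mu _ mI _ _ `|w| (@g_sub_integrable c a b x)).
  exact: leb_measurable_sinc.
by move=> y _; exact: sinc_bound.
Qed.

Lemma star_oc : exists2 al : R, 0 < al & 
  \int[mu]_(u in `]0, al]) ((g u - 2 * f t) * (sin (w * u) / u)) @[w --> +oo] --> (0 : R).
Proof.
have [al al0 star] := f_star; exists al => //.
apply: cvg_ext star => w.
have gE u : f (t + u) - 2 * f t + f (t - u) = g u - 2 * f t by rewrite /g addrAC.
under eq_Rintegral do rewrite gE.
by rewrite -Rintegral_leb_oc // ltW.
Qed.

(** Apply the Fejer argument to g - 2 f(t) and to its opposite. *)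
Lemma star_midpoint : 2 * f t = fr + fl.
Proof.
have [al al0 star] := star_oc.
have gl : g u - 2 * f t @[u --> 0^'+] --> fr + fl - 2 * f t.
  by apply: cvgB; [exact: g_cvg|exact: cvg_cst].
have l1 : fr + fl - 2 * f t <= 0.
  exact: Fejer_limit_le0 al0 (@g_sub_integrable (2 * f t) 0 al false) gl star.
have l2 : - (fr + fl - 2 * f t) <= 0.
  apply: (@Fejer_limit_le0 R al _ (fun u => -1 * (g u - 2 * f t)) al0).
  - rewrite (_ : _ \o _ = fun u => ((-1)%:E * (EFin \o (fun u => (g u - 2 * f t)%R)) u)%E) //.
    by apply: integrableZl; [exact: leb_measurable_itv|exact: g_sub_integrable].
  - by apply: cvg_ext (cvgN gl) => u; rewrite mulN1r.
  - rewrite -[X in _ --> X]oppr0; apply: cvg_ext (cvgN star) => w; rewrite /= -[LHS]mulN1r.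
    rewrite -RintegralZl //; [|exact: leb_measurable_itv].
    by apply: eq_Rintegral => u _; rewrite mulrA.
by lra.
Qed.

(** Split at the radius al of the hypothesis: near 0 the function g may be
    replaced by 2 f(t), which leaves a Dirichlet integral; the rest tends to 0
    by the Riemann-Lebesgue lemma. *)
Lemma sinc_integral_cvg :
  \int[mu]_(u in D) (g u * (sin (r * u) / u)) @[r --> +oo] --> pi / 2 * (fr + fl).
Proof.
have [al al0 star] := star_oc.
have mE : measurable (`]al, +oo[ : set (lebT R)) by exact: leb_measurable_itv.
have mO : measurable (`]0, al] : set (lebT R)) by exact: leb_measurable_itv.
have igE : mu.-integrable `]al, +oo[ (EFin \o g).
  exact: ig.
have iE : mu.-integrable `]al, +oo[ (EFin \o (fun u => g u * u^-1)).
  apply: (@integrable_mul_bounded _ _ _ mu _ mE _ _ al^-1 igE).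
    exact: leb_measurable_inv.
  move=> u /=; rewrite in_itv /= andbT => alu.
  have u0 := lt_trans al0 alu.
  by rewrite gtr0_norm ?invr_gt0 // lef_pV2 ?posrE // ltW.
have lim := cvgD (cvgD star (cvgM (cvg_cst (2 * f t)) (dirichlet_cvg al0)))
  (Riemann_Lebesgue mE iE).
have limE : 2 * f t * (pi / 2) = pi / 2 * (fr + fl) by rewrite star_midpoint mulrC.
rewrite add0r addr0 limE in lim.
apply: cvg_ext (lim _ _ _ _) => w.
rewrite -[LHS]/(\int[mu]_(u in `]0, al]) ((g u - 2 * f t) * (sin (w * u) / u)) +
  2 * f t * \int[mu]_(u in `]0, al]) (sin (w * u) / u) +
  \int[mu]_(u in `]al, +oo[) (g u * u^-1 * sin (w * u))).
have igs : mu.-integrable D (EFin \o (fun u => g u * (sin (w * u) / u))).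
  apply: (@integrable_mul_bounded _ _ _ mu _ mD _ _ `|w| (ig mD)).
    exact: leb_measurable_sinc.
  by move=> x _; exact: sinc_bound.
have isinc : mu.-integrable `]0, al] (EFin \o (fun u => sin (w * u) / u)).
  have i1 : mu.-integrable `]0, al] (EFin \o fun=> (1 : R)) by exact: leb_integrable_cst.
  have := @integrable_mul_bounded _ _ _ mu _ mO _ _ `|w| i1 (@leb_measurable_sinc R _ w)
     (fun x _ => sinc_bound w x).
  by under [X in EFin \o X]eq_fun do rewrite mul1r.
rewrite [RHS](@Rintegral_leb_split _ _ (BRight al) _ _ _ _ igs) ?bnd_simp ?(ltW al0) //.
congr (_ + _); last by apply: eq_Rintegral => u _; rewrite -mulrA [_^-1 * _]mulrC.
rewrite -RintegralZl // -RintegralD //.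
  by apply: eq_Rintegral => u _; rewrite -mulrDl subrK.
have i2 : mu.-integrable `]0, al] (EFin \o fun=> 2 * f t) by exact: leb_integrable_cst.
apply: (@integrable_mul_bounded _ _ _ mu _ mO _ _ `|w| i2 (@leb_measurable_sinc R _ w)).
by move=> x _; exact: sinc_bound.
Qed.

End PointwiseInversion.

(** * Inversion in the algebra *)

Section RintegralSum.
Variables (R : realType) (d : measure_display) (T : measurableType d).
Variables (mu : {measure set T -> \bar R}) (D : set T).
Hypothesis mD : measurable D.

Lemma Rintegral_sum (I : Type) (s : seq I) (F : I -> T -> R) :
  (forall i, mu.-integrable D (EFin \o F i)) ->
  mu.-integrable D (EFin \o (fun x => \sum_(i <- s) F i x)) /\
  \int[mu]_(x in D) (\sum_(i <- s) F i x) = \sum_(i <- s) \int[mu]_(x in D) F i x.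
Proof.
move=> iF; elim: s => [|i s [IH1 IH2]].
  rewrite (_ : (fun x => _) = fun=> 0); last by apply/funext => x; rewrite big_nil.
  by split; [exact: integrable0|rewrite big_nil Rintegral_cst // mul0r].
rewrite (_ : (fun x => _) = fun x => F i x + \sum_(i <- s) F i x); last first.
  by apply/funext => x; rewrite big_cons.
split; last by rewrite RintegralD // IH2 big_cons.
rewrite (_ : _ \o _ = (EFin \o F i) \+ (EFin \o (fun x => (\sum_(i <- s) F i x)%R)))%E //.
exact: integrableD.
Qed.

End RintegralSum.

Section Inversion.
Variables (R : realType) (n : nat) (f : R -> R) (t fr fl : R).
Local Notation mu := (leb : {measure set (lebT R) -> \bar R}).
Hypothesis f_L1 : mu.-integrable setT (EFin \o f).

Let A (w : R) : R := \int[mu]_x (f x * cos (w * (x - t))).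
Let B (w : R) : R := - \int[mu]_x (f x * sin (w * (x - t))).

Let ic (v : R) : mu.-integrable setT (EFin \o (fun x => f x * cos (v * x))).
Proof.
have := integrable_fourier_cos 0 f_L1 v.
by under [X in EFin \o X]eq_fun do rewrite subr0.
Qed.

Let isn (v : R) : mu.-integrable setT (EFin \o (fun x => f x * sin (v * x))).
Proof.
have := integrable_fourier_sin 0 f_L1 v.
by under [X in EFin \o X]eq_fun do rewrite subr0.
Qed.

Let iscale (h : R -> R) (c : R) : mu.-integrable setT (EFin \o h) ->
  mu.-integrable setT (EFin \o (fun x => h x * c)).
Proof.
by move=> ih; apply: (@integrable_mul_bounded _ _ _ mu _ measurableT _ (fun=> c) `|c| ih).
Qed.

(** The coefficients of e^(- x omega) are linear combinations of cos(x Omega_p)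
    and sin(x Omega_p), so each coefficient of the transform is a finite sum of
    ordinary cosine and sine integrals. *)
Lemma mcx_fourier_hat (w : 'I_n.+1 -> R) :
  mcx_fourier f (mcx_hat w) =
  \sum_(p < 2 ^ n) mcx_cplx n (\int[mu]_x (f x * cos (mcx_Omega w p * x)))
     (- \int[mu]_x (f x * sin (mcx_Omega w p * x))) * mcx_idem R p.
Proof.
apply/ffunP => S; rewrite ffunE mcx_comp_coef.
pose F p x := f x * cos (mcx_Omega w p * x) * mcx_idem R p S +
   f x * sin (mcx_Omega w p * x) * - (mcx_gen R ord0 * mcx_idem R p) S.
transitivity (\int[mu]_x (\sum_(p < 2 ^ n) F p x)).
  apply: eq_Rintegral => x _; rewrite -scaleNr mcx_exp_hat mcx_comp_coef mulr_sumr.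
  apply: eq_bigr => p _; rewrite /F mulNr cosN sinN [x * _]mulrC.
  by rewrite mulrDr mulNr !mulrN !mulrA.
have iF p : mu.-integrable setT (EFin \o F p).
  rewrite (_ : _ \o _ = (EFin \o (fun x => (f x * cos (mcx_Omega w p * x) * mcx_idem R p S)%R))
   \+ (EFin \o (fun x => (f x * sin (mcx_Omega w p * x) *
        - (mcx_gen R ord0 * mcx_idem R p) S)%R)))%E //.
  by apply: integrableD => //; exact: iscale.
rewrite (Rintegral_sum _ _ _).2 //; apply: eq_bigr => p _.
rewrite RintegralD //; [|exact: iscale|exact: iscale].
by rewrite !RintegralZr // mulNr mulrN.
Qed.

(** Multiplication by cos(t v) + i_0 sin(t v) turns the phase v x into v (x - t). *)
Lemma mcx_Phi_hat (w : 'I_n.+1 -> R) :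
  mcx_fourier f (mcx_hat w) * mcx_exp (t *: mcx_hat w) =
  \sum_(p < 2 ^ n) mcx_cplx n (A (mcx_Omega w p)) (B (mcx_Omega w p)) * mcx_idem R p.
Proof.
rewrite mcx_fourier_hat mcx_exp_hat mcx_compM; apply: eq_bigr => p _.
move: (mcx_Omega w p) => v; congr (mcx_cplx n _ _ * _).
  rewrite /A mulNr opprK -!RintegralZr // -RintegralD //; [|exact: iscale|exact: iscale].
  by apply: eq_Rintegral => x _; rewrite mulrBr cosB (mulrC t); ring.
rewrite /B mulNr -!RintegralZr // -RintegralB //; [|exact: iscale|exact: iscale].
rewrite -[RHS]mulN1r -RintegralZl //; last exact: integrable_fourier_sin.
by apply: eq_Rintegral => x _; rewrite mulrBr sinB (mulrC t); ring.
Qed.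

(** The components are A and B for every p.  Folded at t they are a cosine
    transform, whose partial integrals tend to 2 (pi/2) (fr + fl), and a sine
    transform, whose partial integrals vanish. *)
Lemma mcx_integral_inversion (Phi := fun x : mcx R n.+1 => mcx_fourier f x * mcx_exp (t *: x)) :
  f x @[x --> t^'+] --> fr -> f x @[x --> t^'-] --> fl -> condition_star f t ->
  is_mcx_integral Phi (\sum_(p < 2 ^ n)
    (mcx_gen R ord0 * mcx_cplx n (2 * pi * ((fr + fl) / 2)) 0) * mcx_idem R p).
Proof.
move=> f_right f_left f_star.
have mD : measurable (`]0, +oo[ : set (lebT R)) by exact: leb_measurable_itv.
have [i1 i2] := integrable_leb_reflections t mD f_L1.
pose g u := f (t + u) + f (t - u); pose h u := f (t + u) - f (t - u).
have ig : mu.-integrable `]0, +oo[ (EFin \o g).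
  rewrite (_ : _ \o _ = (EFin \o (fun u => f (t + u))) \+ (EFin \o (fun u => f (t - u))))%E //.
  exact: integrableD.
have ih : mu.-integrable `]0, +oo[ (EFin \o h).
  rewrite (_ : _ \o _ = (EFin \o (fun u => f (t + u))) \- (EFin \o (fun u => f (t - u))))%E //.
  exact: integrableB.
have AE : A = fun w => \int[mu]_(u in `]0, +oo[) (g u * cos (w * u)).
  by apply/funext => w; exact: fourier_cos_fold.
have BE : B = fun w => - \int[mu]_(u in `]0, +oo[) (h u * sin (w * u)).
  by apply/funext => w; congr (- _); exact: fourier_sin_fold.
have cA : continuous A by rewrite AE; exact: continuous_cosine_transform.
have cS := continuous_sine_transform ih.
have cB : continuous B by rewrite BE => w; apply: cvgN; exact: cS.
exists (fun=> A), (fun=> B), (fun=> 2 * pi * ((fr + fl) / 2)), (fun=> 0); split => //.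
- exact: mcx_Phi_hat.
- by move=> _ r; split; exact: continuous_leb_integrable.
- move=> _; split.
    have lim := sinc_integral_cvg f_L1 f_right f_left f_star.
    have -> : 2 * pi * ((fr + fl) / 2) = 2 * (pi / 2 * (fr + fl)) by field.
    have lim2 := cvgM (cvg_cst (2 : R)) lim.
    apply: cvg_trans (lim2 _ _); apply: near_eq_cvg; near=> r.
    have r0 : 0 <= r by near: r; exact: nbhs_pinfty_ge.
    by rewrite AE (Rintegral_cosine_transform ig r0).
  apply: cvg_near_cst; near=> r.
  have r0 : 0 <= r by near: r; exact: nbhs_pinfty_ge.
  rewrite BE; under eq_Rintegral do rewrite -mulN1r.
  rewrite RintegralZl //; last exact: continuous_leb_integrable.
    by rewrite (Rintegral_sine_transform ih r0) mulr0.
  exact: leb_measurable_itv.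
Unshelve. all: by end_near.
Qed.

End Inversion.

Theorem theoremV2p3 (R : realType) (n : nat) (f : R -> R) (t fr fl : R)
    (f_L1 : leb.-integrable setT (EFin \o f))
    (f_right : f x @[x --> t^'+] --> fr)
    (f_left : f x @[x --> t^'-] --> fl)
    (f_star : condition_star f t) :
  let Phi := fun x : mcx R n.+1 => mcx_fourier f x * mcx_exp (t *: x) in
  mcx_integrable Phi /\
  ((fr + fl) / 2)%:A = ((2 * pi) *: mcx_gen R ord0)^-1 * mcx_integral Phi.
Proof.
move=> Phi.
have iPhi := mcx_integral_inversion n f_L1 f_right f_left f_star.
split; first by exists (\sum_(p < 2 ^ n)
  (mcx_gen R ord0 * mcx_cplx n (2 * pi * ((fr + fl) / 2)) 0) * mcx_idem R p).
rewrite (_ : mcx_integral Phi = \sum_(p < 2 ^ n)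
  (mcx_gen R ord0 * mcx_cplx n (2 * pi * ((fr + fl) / 2)) 0) * mcx_idem R p).
  by rewrite mcx_2pi_i0_inv.
rewrite /mcx_integral; case: xgetP => [v _ iv|/(_ _ iPhi) //].
exact: is_mcx_integral_unique iv iPhi.
Qed.
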